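(* Let $n\in\mathbb{N}$. A (non $U(1)$-equivariant) isomorphism $\psi:C^*(\widetilde{\Sigma}_n)\to C^*(\Sigma_n)$ is given by $$\psi(P_{w_i})=P_{v_i},\qquad \psi(S_{e_i})=S_{e_{i,i}},\qquad \psi(S_{f_j})=\sum_{k=j+1}^nS_{e_{j,k}}S_{e_{j+1,k}}^*,$$ for all $0\leq i\leq n$ and $0\leq j<n$. The inverse map is given on generators by $$\psi^{-1}(P_{v_i})=P_{w_i},\qquad \psi^{-1}(S_{e_{i,i}})=S_{e_i},\qquad \psi^{-1}(S_{e_{j,k}})=S_{f_j}S_{f_{j+1}}\cdots S_{f_{k-1}}S_{e_k},$$ for all $0\leq i\leq n$ and for all $0\leq j<k\leq n$.
   Context: $\mathbb{N}=\{0,1,2,\dots\}$. $\Sigma_n$ is the directed graph with $n+1$ vertices $v_0,\ldots,v_n$ and one edge $e_{i,j}$ from $v_i$ to $v_j$ for all $0\leq i\leq j\leq n$. $\widetilde{\Sigma}_n$ is the directed graph with $n+1$ vertices $w_0,\ldots,w_n$, one edge $f_i$ from $w_i$ to $w_{i+1}$ for all $0\leq i<n$, and one loop $e_i$ at $w_i$ for all $0\leq i\leq n$. For a row-finite directed graph $E=(E^0,E^1,s,t)$ ($s$ source map, $t$ target map; row-finite means that every vertex emits finitely many edges), the graph C*-algebra $C^*(E)$ is the universal C*-algebra generated by mutually orthogonal projections $\{P_v:v\in E^0\}$ and partial isometries $\{S_e:e\in E^1\}$ satisfying $S_e^*S_e=P_{t(e)}$ for all $e\in E^1$ and $\sum_{e\in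 E^1:\,s(e)=v}S_eS_e^*=P_v$ for every $v\in E^0$ that is not a sink (a sink is a vertex with no outgoing edges). The same letters $P,S$ are used for the generators of both graph C*-algebras. The $U(1)$-action on $C^*(E)$ is the gauge action, given on generators by $P_v\mapsto P_v$, $S_e\mapsto uS_e$ for $u\in U(1)$.
   Formalization: The isomorphism and its inverse are proved for all n, but non-U(1)-equivariance is claimed only for n ≥ 1: for n = 0 both graphs are a single loop and ψ maps generator to generator, so it is equivariant. *)

(* Defs.v *)
From HB Require Import structures.
From mathcomp Require Import all_boot all_order all_algebra.
From mathcomp Require Import complex.
From mathcomp Require Import all_classical all_reals all_analysis.

Set Implicit Arguments.
Unset Strict Implicit.
Unset Printing Implicit Defensive.

Import Order.TTheory GRing.Theory Num.Theory.
Import numFieldNormedType.Exports.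

Local Open Scope classical_set_scope.
Local Open Scope ring_scope.

Reserved Notation "x *c y" (at level 40, left associativity).
Reserved Notation "x ^*c" (at level 1, left associativity, format "x ^*c").

(* C*-algebras are not assumed to be unital, hence not MathComp (pz)rings.
   The norm takes its values in R[i] (in its nonnegative real part). *)
HB.mixin Record CompleteNormedModule_isCStarAlgebra (R : realType) A
    & CompleteNormedModule R[i] A := {
  cmul : A -> A -> A ;
  cstar : A -> A ;
  cmulA : associative cmul ;
  cmulDl : left_distributive cmul +%R ;
  cmulDr : right_distributive cmul +%R ;
  cmulZl : forall (c : R[i]) (x y : A), cmul (c *: x) y = c *: cmul x y ;
  cmulZr : forall (c : R[i]) (x y : A), cmul x (c *: y) = c *: cmul x y ;
  cstarK : involutive cstar ;
  cstarD : {morph cstar : x y / x + y} ;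
  cstarZ : forall (c : R[i]) (x : A), cstar (c *: x) = (Num.conj c) *: cstar x ;
  cstarM : forall x y : A, cstar (cmul x y) = cmul (cstar y) (cstar x) ;
  cnormM : forall x y : A, `|cmul x y| <= `|x| * `|y| ;
  cnorm_star : forall x : A, `|cmul (cstar x) x| = `|x| ^+ 2
}.

#[short(type="cstarAlgType")]
HB.structure Definition CStarAlgebra (R : realType) :=
  {A of CompleteNormedModule_isCStarAlgebra R A & CompleteNormedModule R[i] A}.

Notation "x *c y" := (cmul x y) : ring_scope.
Notation "x ^*c" := (cstar x) : ring_scope.

Record star_hom (R : realType) (A B : cstarAlgType R) (phi : A -> B) : Prop :=
  StarHom {
    star_homD : forall x y, phi (x + y) = phi x + phi y ;
    star_homZ : forall (c : R[i]) x, phi (c *: x) = c *: phi x ;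
    star_homM : forall x y, phi (x *c y) = phi x *c phi y ;
    star_homS : forall x, phi x^*c = (phi x)^*c
  }.

Record closed_star_subalgebra (R : realType) (A : cstarAlgType R)
    (D : set A) : Prop := ClosedStarSubalgebra {
  subalg_topclosed : closed D ;
  subalg0 : D 0 ;
  subalgD : forall x y, D x -> D y -> D (x + y) ;
  subalgZ : forall (c : R[i]) x, D x -> D (c *: x) ;
  subalgM : forall x y, D x -> D y -> D (x *c y) ;
  subalgS : forall x, D x -> D x^*c
}.

Definition is_projection (R : realType) (A : cstarAlgType R) (p : A) : Prop :=
  p *c p = p /\ p^*c = p.

Definition is_partial_isometry (R : realType) (A : cstarAlgType R) (s : A) :
  Prop := s *c s^*c *c s = s.

Record rf_digraph := RfDigraph {
  vertex : choiceType ;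
  edge : choiceType ;
  source : edge -> vertex ;
  target : edge -> vertex ;
  row_finite : forall v, finite_set [set e | source e = v]
}.

Definition is_sink (E : rf_digraph) (v : vertex E) : Prop :=
  forall e : edge E, source e <> v.

Record ck_family (R : realType) (E : rf_digraph) (A : cstarAlgType R)
    (P : vertex E -> A) (S : edge E -> A) : Prop := CKFamily {
  ck_proj : forall v, is_projection (P v) ;
  ck_orth : forall v w, v <> w -> P v *c P w = 0 ;
  ck_piso : forall e, is_partial_isometry (S e) ;
  ck_target : forall e, (S e)^*c *c S e = P (target e) ;
  ck_source : forall v, ~ is_sink v ->
    \sum_(e \in [set e | source e = v]) (S e *c (S e)^*c) = P v
}.

(* A model of C^*(E), i.e. of the universal C*-algebra generated by a
   Cuntz-Krieger E-family; any two models are canonically isomorphic. *)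
Record graph_cstar (R : realType) (E : rf_digraph) := GraphCStar {
  gcarrier :> cstarAlgType R ;
  gP : vertex E -> gcarrier ;
  gS : edge E -> gcarrier ;
  g_family : ck_family gP gS ;
  g_generated : forall D : set gcarrier, closed_star_subalgebra D ->
    (forall v, D (gP v)) -> (forall e, D (gS e)) -> D = setT ;
  g_universal : forall (B : cstarAlgType R) (Q : vertex E -> B)
      (T : edge E -> B), ck_family Q T ->
    exists! phi : gcarrier -> B, [/\ star_hom phi,
      forall v, phi (gP v) = Q v & forall e, phi (gS e) = T e]
}.

Arguments gP {R E} g v.
Arguments gS {R E} g e.

(* U(1) is {u : R[i] | `|u| = 1}; the values of gamma elsewhere are
   irrelevant. The conditions determine gamma on U(1). *)
Record gauge_action (R : realType) (E : rf_digraph) (A : graph_cstar R E)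
    (gamma : R[i] -> A -> A) : Prop := GaugeAction {
  gauge_hom : forall u, `|u| = 1 -> star_hom (gamma u) ;
  gauge1 : gamma 1 =1 id ;
  gaugeM : forall u v, `|u| = 1 -> `|v| = 1 ->
    gamma (u * v) =1 gamma u \o gamma v ;
  gaugeP : forall u v, `|u| = 1 -> gamma u (gP A v) = gP A v ;
  gaugeS : forall u e, `|u| = 1 -> gamma u (gS A e) = u *: gS A e
}.

Definition u1_equivariant (R : realType) (E F : rf_digraph)
    (A : graph_cstar R E) (B : graph_cstar R F) (psi : A -> B) : Prop :=
  forall (gammaA : R[i] -> A -> A) (gammaB : R[i] -> B -> B),
    gauge_action gammaA -> gauge_action gammaB ->
    forall u, `|u| = 1 -> forall a, psi (gammaA u a) = gammaB u (psi a).

Section Graphs.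
Variable n : nat.

(* e_{i,j} is the pair (i, j). *)
Definition sigma_edge : finType := {ij : 'I_n.+1 * 'I_n.+1 | (ij.1 <= ij.2)%N}.

Definition sigma_source (e : sigma_edge) : 'I_n.+1 := (val e).1.
Definition sigma_target (e : sigma_edge) : 'I_n.+1 := (val e).2.

Lemma sigma_row_finite (v : 'I_n.+1) :
  finite_set [set e | sigma_source e = v].
Proof. exact: finite_finset. Qed.

Definition Sigma : rf_digraph :=
  @RfDigraph 'I_n.+1 sigma_edge sigma_source sigma_target sigma_row_finite.

(* The loop e_i is inl i, and f_j is inr j. *)
Definition sigmat_edge : finType := ('I_n.+1 + 'I_n)%type.

Definition sigmat_source (e : sigmat_edge) : 'I_n.+1 :=
  match e with inl i => i | inr j => widen_ord (leqnSn n) j end.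
Definition sigmat_target (e : sigmat_edge) : 'I_n.+1 :=
  match e with inl i => i | inr j => lift ord0 j end.

Lemma sigmat_row_finite (v : 'I_n.+1) :
  finite_set [set e | sigmat_source e = v].
Proof. exact: finite_finset. Qed.

Definition Sigmat : rf_digraph :=
  @RfDigraph 'I_n.+1 sigmat_edge sigmat_source sigmat_target
    sigmat_row_finite.

End Graphs.

(* S_{e_{i,j}} in C^*(Sigma_n); the default value 0, for j < i, is never used. *)
Definition Se (R : realType) (n : nat) (B : graph_cstar R (Sigma n))
    (i j : 'I_n.+1) : B :=
  if (insub (i, j) : option (sigma_edge n)) is Some e then gS B e else 0.

Definition Sloop (R : realType) (n : nat) (A : graph_cstar R (Sigmat n))
    (i : 'I_n.+1) : A := gS A (inl i : sigmat_edge n).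

Definition Sf (R : realType) (n : nat) (A : graph_cstar R (Sigmat n))
    (j : 'I_n) : A := gS A (inr j : sigmat_edge n).

(* S_{f_j} S_{f_{j+1}} ... S_{f_{k-1}} S_{e_k}, for j < k; a fold, for want of
   a unit. *)
Definition Spath (R : realType) (n : nat) (A : graph_cstar R (Sigmat n))
    (j k : 'I_n.+1) : A :=
  foldr (fun (i : 'I_n) x => Sf A i *c x) (Sloop A k)
    [seq i : 'I_n <- enum 'I_n | (j <= i < k)%N].

(* Main.v *)
From HB Require Import structures.
Require Import Defs.
From mathcomp Require Import all_boot all_order all_algebra.
From mathcomp Require Import complex.
From mathcomp Require Import all_classical all_reals all_analysis.
From mathcomp Require Import zify ring lra.
From mathcomp Require finmap.

(** Write P, S for the generators of both algebras.  Inside C^*(Sigma_n) the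
    elements F_j := sum_{k > j} S_{e_{j,k}} S_{e_{j+1,k}}^* satisfy the relations
    of the edges f_j, and inside C^*(Sigmat_n) the path elements
    T_{j,k} := S_{f_j} ... S_{f_{k-1}} S_{e_k} satisfy those of the edges
    e_{j,k}.  Both are direct computations: multiplication by F_j turns
    S_{e_{j+1,k}} into S_{e_{j,k}} ([Sf_image_mul]), and descending induction on
    j gives sum_{k >= j} T_{j,k} T_{j,k}^* = P_{w_j} ([Spath_source]).
    Universality yields psi and psi_inv; they exchange F_j with S_{f_j} and
    S_{e_{j,k}} with T_{j,k}, so both composites fix the generators and are
    identities by the uniqueness half of universality.

    The computations use that S_e^* S_f = 0 for distinct edges, whereas the
    defining relations only say that the range projections of the edges leaving
    v add up to a projection.  That projections summing to a projection are
    orthogonal is a positivity statement.  It is obtained here without spectral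
    theory, from the norm alone ([sum_projections_orthogonal]): in the corner
    of a projection q, say that y is positive when |t q - y| <= t for some t.
    If y and -y are both positive and y is self-adjoint, then q + z y is a
    contraction for all small z that are real or imaginary.  Averaging squares,
    (q + z y)^2 + (q + i z y)^2 = 2 (q + (1 + i) z y), so z may be multiplied by
    1 + i, of modulus > 1, as often as desired; hence y = 0.

    The isomorphism is not equivariant because the gauge action fixes F_j and
    multiplies S_{f_j} by u: for u = -1, equivariance would give S_{f_0} = 0 and
    hence P_{w_1} = 0.  Refuting this requires a C*-algebra with a
    Cuntz-Krieger family in which P_{w_1} does not vanish.  Then S_{e_0} has
    initial projection P_{w_0} and a strictly smaller range, so no
    finite-dimensional algebra will do.  The algebra of bounded operators on
    l^2 is built as an algebra of infinite matrices, and the unilateral shift s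
    supplies the family, with P_{w_1} := 1 - s s^* ([toeplitz_family]). *)
Set Implicit Arguments.
Unset Strict Implicit.
Unset Printing Implicit Defensive.
Import Order.TTheory GRing.Theory Num.Theory.
Import numFieldNormedType.Exports.
Local Open Scope classical_set_scope.
Local Open Scope ring_scope.
Local Open Scope complex_scope.

Local Notation Re := (@complex.Re _).
Local Notation Im := (@complex.Im _).

(** * Complex numbers and their completeness *)

Section ComplexLimits.
Variable R : realType.
Local Notation C := R[i].

Lemma gtc0P (e : C) : 0 < e -> exists2 r : R, 0 < r & e = r%:C.
Proof.
case: e => a b; rewrite ltcE /= => /andP[/eqP -> a0]; by exists a.
Qed.

Lemma gec0P (e : C) : 0 <= e -> exists2 r : R, 0 <= r & e = r%:C.
Proof.
case: e => a b; rewrite lecE /= => /andP[/eqP -> a0]; by exists a.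
Qed.

(** The order of the complex numbers is partial, so the usual argument for
    total orders does not apply; here the imaginary parts agree because one e
    gives comparability, and the real parts are compared as usual. *)
Lemma lec_epsilon (x y : C) : (forall e : C, 0 < e -> x <= y + e) -> x <= y.
Proof.
move=> h; rewrite lecE.
have h' (r : R) : 0 < r -> (Im y == Im x) && (Re x <= Re y + r).
  move=> r0; have := h (real_complex R r); rewrite ltcR => /(_ r0); rewrite lecE.
  by case: (y) => /= ? ?; rewrite addr0.
have /andP[-> _] /= := h' 1 ltr01.
by apply/ler_addgt0Pr => r /h' /andP[].
Qed.

Lemma Re_norm_le (x : C) : `|Re x|%:C <= `|x|.
Proof. exact: normc_ge_Re. Qed.

Lemma Im_norm_le (x : C) : `|Im x|%:C <= `|x|.
Proof.
have -> : Im x = Re (- 'i%C * x) by case: x => a b /=; lra.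
apply: le_trans (normc_ge_Re _) _.
rewrite normrM normrN (_ : `|'i%C : C| = 1) ?mul1r //.
by rewrite normc_def /= expr0n add0r expr1n sqrtr1.
Qed.

Lemma norm_le_ReIm (x : C) : `|x| <= `|Re x|%:C + `|Im x|%:C.
Proof.
have nR (r : R) : `|r|%:C = `|r%:C : C|.
  by rewrite normc_def /= expr0n addr0 sqrtr_sqr.
have i1 : `|'i%C : C| = 1.
  by rewrite normc_def /= expr0n add0r expr1n sqrtr1.
rewrite {1}(complexE x) (le_trans (ler_normD _ _)) // normrM i1 mul1r.
by rewrite !nR.
Qed.

(** Completeness is inherited from the real line through real and imaginary
    parts, which are 1-Lipschitz.  The topology is that of the regular module
    C^o. *)
Lemma complex_complete (F : set_system C^o) :
  ProperFilter F -> cauchy F -> cvg F.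
Proof.
move=> FF /cauchyP Fc.
have cau (f : C -> R) : (forall x y, `|f x - f y|%:C <= `|x - y|) ->
    cvg (f @ F).
  move=> fL; apply: R_complete; apply: cauchy_exP => e e0.
  have [z Fz] := Fc (real_complex R e) ltac:(by rewrite ltcR).
  exists (f z); change (F (f @^-1` ball (f z) e)).
  apply: filterS Fz => x zx; rewrite /preimage /ball /= -ltcR.
  exact: le_lt_trans (fL _ _) zx.
have /cvg_ex[/= a aF] : cvg (Re @ F).
  by apply: cau => x y; rewrite -raddfB Re_norm_le.
have /cvg_ex[/= b bF] : cvg (Im @ F).
  by apply: cau => x y; rewrite -raddfB Im_norm_le.
apply/cvg_ex; exists ((a +i* b) : C^o).
apply/cvgrPdist_lt => /= _ /gtc0P[r r0 ->].
have r2 : 0 < r / 2 by rewrite divr_gt0.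
move/cvgrPdist_lt : aF => /(_ _ r2); rewrite near_simpl => aF.
move/cvgrPdist_lt : bF => /(_ _ r2); rewrite near_simpl => bF.
near=> z.
apply: le_lt_trans (norm_le_ReIm _) _.
rewrite -rmorphD ltcR (splitr r) ltrD//.
  rewrite raddfB /=; near: z; exact: aF.
rewrite raddfB /=; near: z; exact: bF.
Unshelve. all: by end_near. Qed.

Lemma norm_lim_le (T : Type) (F : set_system T) (FF : ProperFilter F)
    (f : T -> C^o) (l : C^o) (B : C) : f @ F --> l ->
  (\forall t \near F, `|f t| <= B) -> `|l| <= B.
Proof.
move=> /cvgrPdist_lt fl fB; apply: lec_epsilon => e /fl le.
have [t [tB tl]] := filter_ex (filterI fB le).
by rewrite -(subrK (f t) l) addrC (le_trans (ler_normD _ _)) // lerD // ltW.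
Qed.

End ComplexLimits.

(** * Projections summing to a projection *)

Section CStarBasics.
Variables (R : realType) (A : cstarAlgType R).
Local Notation C := R[i].
Implicit Types (x y z p q r : A).

Lemma cmul0 x : x *c 0 = 0.
Proof. by apply: (addrI (x *c 0)); rewrite -cmulDr !addr0. Qed.
Lemma cmul0l x : 0 *c x = 0.
Proof. by apply: (addrI (0 *c x)); rewrite -cmulDl !addr0. Qed.
Lemma cmulNr x y : x *c (- y) = - (x *c y).
Proof. by apply: (addrI (x *c y)); rewrite -cmulDr !subrr cmul0. Qed.
Lemma cmulNl x y : (- x) *c y = - (x *c y).
Proof. by apply: (addrI (x *c y)); rewrite -cmulDl !subrr cmul0l. Qed.
Lemma cmulBr x y z : x *c (y - z) = x *c y - x *c z.
Proof. by rewrite cmulDr cmulNr. Qed.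
Lemma cmulBl x y z : (x - y) *c z = x *c z - y *c z.
Proof. by rewrite cmulDl cmulNl. Qed.
Lemma cstar0 : (0 : A)^*c = 0.
Proof. by apply: (addrI (0 : A)^*c); rewrite -cstarD !addr0. Qed.
Lemma cstarN x : (- x)^*c = - x^*c.
Proof. by apply: (addrI x^*c); rewrite -cstarD !subrr cstar0. Qed.
Lemma cstarB x y : (x - y)^*c = x^*c - y^*c.
Proof. by rewrite cstarD cstarN. Qed.

Lemma cmul_sumr (I : Type) (r : seq I) (P : pred I) (F : I -> A) x :
  x *c (\sum_(i <- r | P i) F i) = \sum_(i <- r | P i) x *c F i.
Proof. exact: (big_morph _ (cmulDr x) (cmul0 x)). Qed.
Lemma cmul_suml (I : Type) (r : seq I) (P : pred I) (F : I -> A) x :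
  (\sum_(i <- r | P i) F i) *c x = \sum_(i <- r | P i) F i *c x.
Proof.
exact: (big_morph (fun y => y *c x) (fun y z => cmulDl y z x) (cmul0l x)).
Qed.
Lemma cstar_sum (I : Type) (r : seq I) (P : pred I) (F : I -> A) :
  (\sum_(i <- r | P i) F i)^*c = \sum_(i <- r | P i) (F i)^*c.
Proof. exact: (big_morph _ (@cstarD _ _) cstar0). Qed.

Lemma star_mul_eq0 x : x^*c *c x = 0 -> x = 0.
Proof.
move=> xx; have : `|x| ^+ 2 == 0 by rewrite -cnorm_star xx normr0.
by rewrite expf_eq0 normr_eq0 => /eqP.
Qed.

Lemma norm_sq_le1 x : `|x^*c *c x| <= 1 -> `|x| <= 1.
Proof. by rewrite cnorm_star expr_le1. Qed.

(** The C*-identity gives |p|^2 = |p|. *)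
Lemma norm_projection_le1 p : is_projection p -> `|p| <= 1.
Proof.
case=> pp ps; have [->|p0] := eqVneq p 0; first by rewrite normr0.
have := cnorm_star p; rewrite ps pp expr2 -{1}[`|p|]mulr1.
by move=> /(mulfI _) <- //; rewrite normr_eq0.
Qed.

(** With a unit this is the compression by q of the symmetry 1 - 2r.  Without
    one, x := q - 2rq stands for (1 - 2r)q: it satisfies x^* x = q and
    q x = q - 2qrq. *)
Lemma corner_norm_le1 q r : is_projection q -> is_projection r ->
  `|q - (q *c r *c q + q *c r *c q)| <= 1.
Proof.
move=> pq pr; have [[qq qs] [rr rs]] := (pq, pr).
pose x := q - (r *c q + r *c q).
have xE : q *c x = q - (q *c r *c q + q *c r *c q).
  by rewrite cmulBr cmulDr !cmulA qq.
have xx : x^*c *c x = q.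
  rewrite /x cstarB cstarD cstarM qs rs.
  set h := q *c r *c q.
  have e1 : q *c (r *c q) = h by rewrite cmulA.
  have e2 : q *c r *c (r *c q) = h by rewrite cmulA -(cmulA q) rr.
  rewrite !cmulBl !cmulBr !cmulDl !cmulDr qq e1 e2 -/h.
  by rewrite opprB addrK subrK.
have nx : `|x| <= 1 by apply: norm_sq_le1; rewrite xx norm_projection_le1.
by rewrite -xE (le_trans (cnormM _ _)) // mulr_ile1 // norm_projection_le1.
Qed.

Section Corner.
Variable q : A.
Hypothesis pq : is_projection q.

Definition corner x := q *c x = x /\ x *c q = x.

Lemma half_norm_le1 x : `|x + x| <= 2 -> `|x| <= 1.
Proof. by rewrite -mulr2n normrMn lerMn2r. Qed.

(** 2 (q + a + b) = (q + a)^2 + (q + b)^2, since the squares a^2 and b^2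
    cancel. *)
Lemma norm_corner_add a b : corner a -> corner b -> b *c b = - (a *c a) ->
  `|q + a| <= 1 -> `|q + b| <= 1 -> `|q + (a + b)| <= 1.
Proof.
move=> [qa aq] [qb bq] bb na nb; have [qq _] := pq; apply: half_norm_le1.
have -> : q + (a + b) + (q + (a + b)) = (q + a) *c (q + a) + (q + b) *c (q + b).
  rewrite !cmulDl !cmulDr qq qa aq qb bq bb.
  rewrite [RHS](AC ((2*2)*(2*2)) ((1*(2*6))*(5*(3*7))*(4*8))) /=.
  by rewrite subrr addr0.
rewrite (le_trans (ler_normD _ _)) // -[2]/(1 + 1) lerD //.
  by rewrite (le_trans (cnormM _ _)) // mulr_ile1.
by rewrite (le_trans (cnormM _ _)) // mulr_ile1.
Qed.

Lemma cornerZ (c : C) x : corner x -> corner (c *: x).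
Proof. by move=> [qx xq]; split; rewrite ?cmulZl ?cmulZr ?qx ?xq. Qed.

(** If q + w x is a contraction for all quarter turns w of z, then it is one
    for all quarter turns of (1 + i) z by [norm_corner_add].  Iterating,
    |1 + i|^m |z x| stays bounded by |q + w x| + |q| <= 2. *)
Lemma corner_rotation_eq0 (z : C) x : corner x -> z != 0 ->
  (forall k, `|q + ('i ^+ k * z) *: x| <= 1) -> x = 0.
Proof.
move=> cx z0 H.
(* i w is again a quarter turn of z, and (i w)^2 = - w^2. *)
have turn (w : C) : (forall k, `|q + ('i ^+ k * w) *: x| <= 1) ->
    forall k, `|q + ('i ^+ k * ((1 + 'i) * w)) *: x| <= 1.
  move=> Hw k.
  rewrite mulrCA mulrDl mul1r mulrA -exprS scalerDl.
  apply: norm_corner_add => //; [exact: cornerZ | exact: cornerZ |].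
  rewrite !cmulZl !cmulZr !scalerA -scaleNr exprS; congr (_ *: _).
  transitivity ('i ^+ 2 * ('i ^+ k * w * ('i ^+ k * w)) : C); first by ring.
  by rewrite sqrCi mulN1r.
(* Even exponents suffice, and (1 + i)^2 = 2i has modulus 2. *)
have Hm m : forall k, `|q + ('i ^+ k * ((1 + 'i) ^+ m.*2 * z)) *: x| <= 1.
  elim: m => [|m IH] k; first by rewrite mul1r.
  rewrite doubleS !exprS -!mulrA.
  exact: (turn _ (turn _ IH) k).
have bound m : 2 ^+ m * (`|z| * `|x|) <= 2.
  have nc : `|(1 + 'i) ^+ m.*2 : C| = 2 ^+ m.
    have e2 : (1 + 'i) ^+ 2 = 2 * 'i :> C.
      by rewrite sqrrD sqrCi expr1n mul1r addrAC subrr add0r mulr_natl.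
    by rewrite -muln2 mulnC exprM e2 normrX normrM normCi mulr1 ger0_norm.
  rewrite -nc mulrA -normrM -normrZ.
  have := Hm m 0%N; rewrite expr0 mul1r => hm.
  rewrite -[X in `|X|](addKr q) (le_trans (ler_normD _ _)) // normrN.
  by rewrite -[2]/(1 + 1) lerD // norm_projection_le1.
apply/eqP; rewrite -normr_eq0.
have [//|x0] := eqVneq `|x| 0.
have c0 : 0 < `|z| * `|x| by rewrite mulr_gt0 // normr_gt0 // -normr_eq0.
have [r r0 rE] := gtc0P c0.
have h m : m%:R * r <= 2.
  rewrite (le_trans (y := 2 ^+ m * r)) //.
    by rewrite ler_wpM2r ?(ltW r0) // -natrX ler_nat ltnW // ltn_expl.
  have := bound m; rewrite rE.
  rewrite (_ : 2 ^+ m * _ = (2 ^+ m * r)%:C); last by rewrite rmorphM rmorphXn rmorph_nat.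
  by rewrite (_ : 2 = (2 : R)%:C) ?lecR // rmorph_nat.
have := h (Num.bound (2 / r)).
have lt : 2 / r < (Num.bound (2 / r))%:R.
  by apply: archi_boundP; rewrite divr_ge0 // ltW.
by rewrite leNgt -ltr_pdivrMr // lt.
Qed.

Lemma norm_corner_sq a : corner a -> `|q + a| <= 1 -> `|q - a| <= 1 ->
  `|q + a *c a| <= 1.
Proof.
move=> [qa aq] na nb; have [qq _] := pq; apply: half_norm_le1.
have -> : q + a *c a + (q + a *c a) = (q + a) *c (q + a) + (q - a) *c (q - a).
  rewrite !cmulBl !cmulDl !cmulBr !cmulDr qq qa aq opprB.
  rewrite [a *c a - a]addrC.
  rewrite [RHS](AC ((2*2)*(2*2)) ((1*4)*(5*8)*((2*6)*(3*7)))) /=.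
  by rewrite !subrr !addr0.
rewrite (le_trans (ler_normD _ _)) // -[2]/(1 + 1) lerD //.
  by rewrite (le_trans (cnormM _ _)) // mulr_ile1.
by rewrite (le_trans (cnormM _ _)) // mulr_ile1.
Qed.

(** For real w one has |q + i w y|^2 = |q + (w y)^2| by the C*-identity, and
    the right-hand side is the norm of a mean of two squares of contractions.
    So the hypotheses pass from real to imaginary multiples of y. *)
Lemma selfadjoint_corner_eq0 (e : C) y : 0 < e -> corner y -> y^*c = y ->
  `|q + e *: y| <= 1 -> `|q - e *: y| <= 1 -> y = 0.
Proof.
move=> e0 cy ys n1 n2; have ce := cornerZ e cy.
have [qq qs] := pq; have [qe eq] := ce.
have sq : `|q + (e *: y) *c (e *: y)| <= 1 by apply: norm_corner_sq.
have ni (s : C) : s * s = 1 -> s \is Num.real ->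
    `|q + ('i * s * e) *: y| <= 1.
  move=> ss sr; apply: norm_sq_le1; rewrite cstarD cstarZ qs ys.
  have -> : Num.conj ('i * s * e) = - ('i * s * e).
    rewrite !rmorphM /= conjCi (conj_Creal sr) (conj_Creal (x := e)) ?mulNr //.
    by rewrite ger0_real // ltW.
  have [qw wq] := cornerZ ('i * s * e) cy.
  rewrite scaleNr cmulBl !cmulDr qq qw wq cmulZl cmulZr scalerA.
  have -> : 'i * s * e * ('i * s * e) = - (e * e) :> C.
    transitivity ('i ^+ 2 * (s * s) * (e * e) : C); first by ring.
    by rewrite ss sqrCi mulr1 mulN1r.
  rewrite scaleNr opprD addrA addrK opprK.
  by move: sq; rewrite cmulZl cmulZr scalerA.
apply: (@corner_rotation_eq0 e) => // [|k]; first by rewrite gt_eqF.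
have iE (b : bool) m : 'i ^+ (b + m.*2) = 'i ^+ b * (-1) ^+ odd m :> C.
  by rewrite exprD -muln2 mulnC exprM sqrCi signr_odd.
rewrite -(odd_double_half k) iE; case: (odd k); rewrite ?expr1 ?expr0 ?mul1r.
  by apply: ni; rewrite ?rpredX ?rpredN ?rpred1 // -expr2 sqrr_sign.
by case: (odd _); rewrite ?expr1 ?expr0 ?mulN1r ?mul1r ?scaleNr.
Qed.

(** In a unital C*-algebra with unit q this says, for self-adjoint y, that the
    spectrum of y is nonnegative. *)
Definition corner_pos y := exists2 t : C, 0 <= t & `|t *: q - y| <= t.

Lemma corner_posD x y : corner_pos x -> corner_pos y -> corner_pos (x + y).
Proof.
move=> [s s0 sx] [t t0 ty]; exists (s + t); first exact: addr_ge0.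
rewrite scalerDl opprD addrACA (le_trans (ler_normD _ _)) //.
exact: lerD.
Qed.

Lemma corner_pos_sum (I : eqType) (r : seq I) (F : I -> A) :
  (forall i, i \in r -> corner_pos (F i)) -> corner_pos (\sum_(i <- r) F i).
Proof.
move=> FP; rewrite big_seq; elim/big_ind: _ => //; last exact: corner_posD.
by exists 0 => //; rewrite scale0r subrr normr0.
Qed.

(** |q| <= 1 allows t to be enlarged, which makes two witnesses comparable. *)
Lemma corner_pos_mono (s t : C) y : s <= t -> `|s *: q - y| <= s ->
  `|t *: q - y| <= t.
Proof.
move=> st sy; rewrite -{1}(subrK s t) scalerDl -addrA.
rewrite (le_trans (ler_normD _ _)) // -[leRHS](subrK s t) lerD //.
rewrite normrZ ger0_norm ?subr_ge0 //.
by rewrite -[leRHS]mulr1 ler_wpM2l ?subr_ge0 // norm_projection_le1.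
Qed.

(** A common t for y and -y makes q + y/t and q - y/t contractions. *)
Lemma corner_pos_antisym y : corner y -> y^*c = y ->
  corner_pos y -> corner_pos (- y) -> y = 0.
Proof.
move=> cy ys [s s0 sy] [t t0 ty]; pose u := s + t + 1.
have u0 : 0 < u by rewrite ltr_wpDl // addr_ge0.
have su : s <= u by rewrite /u -addrA lerDl addr_ge0.
have tu : t <= u by rewrite /u addrAC lerDr addr_ge0.
have unit_le z : `|u *: q + z| <= u -> `|q + u^-1 *: z| <= 1.
  move=> h; rewrite -(ler_pM2l u0) mulr1 -{1}(ger0_norm (ltW u0)) -normrZ.
  by rewrite scalerDr scalerA mulfV ?gt_eqF // scale1r.
have ei : 0 < u^-1 by rewrite invr_gt0.
apply: (selfadjoint_corner_eq0 ei cy ys).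
  by apply: unit_le; have := corner_pos_mono tu ty; rewrite opprK.
by rewrite -scalerN; apply: unit_le; exact: corner_pos_mono sy.
Qed.

Lemma projection_corner_pos r : is_projection r -> corner_pos (q *c r *c q).
Proof.
move=> pr; exists 2^-1; first by rewrite invr_ge0.
rewrite -[leRHS]mulr1 -ler_pdivrMl ?invr_gt0 // invrK.
rewrite -{1}(ger0_norm (ler0n _ 2)) -normrZ scalerBr scalerA mulfV //.
by rewrite scale1r scaler_nat mulr2n corner_norm_le1.
Qed.

(** This is the compression by q of the projection 1 - r, which need not exist
    in the algebra. *)
Lemma coprojection_corner_pos r : is_projection r ->
  corner_pos (q - q *c r *c q).
Proof.
move=> pr; exists 2^-1; first by rewrite invr_ge0.
rewrite -[leRHS]mulr1 -ler_pdivrMl ?invr_gt0 // invrK.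
rewrite -{1}(ger0_norm (ler0n _ 2)) -normrZ scalerBr scalerA mulfV ?pnatr_eq0 //.
rewrite scale1r scaler_nat mulr2n -normrN opprB.
have := corner_norm_le1 pq pr; congr (`|_| <= 1).
set h := q *c r *c q; rewrite addrACA -opprD.
by rewrite [RHS]addrAC addrK.
Qed.

End Corner.

(** Let q = F j and y = q (F i) q.  Compressing the sum by q gives
    - y = (q - q P q) + sum_{k <> i, j} q (F k) q, so y and -y are both
    positive and y = 0; but y = (F i q)^* (F i q). *)
Lemma sum_projections_orthogonal (I : eqType) (r : seq I) (F : I -> A) P :
  uniq r -> (forall i, i \in r -> is_projection (F i)) ->
  is_projection P -> \sum_(i <- r) F i = P ->
  forall i j, i \in r -> j \in r -> i != j -> F i *c F j = 0.
Proof.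
move=> ur pF pP sumF i j ir jr ij; set q := F j.
have pq : is_projection q by exact: pF.
have [[qq qs] [ii is_]] := (pq, pF i ir).
set y := q *c F i *c q.
suff y0 : y = 0.
  apply: star_mul_eq0.
  by rewrite cstarM is_ qs -!cmulA (cmulA (F i)) ii cmulA.
have ys : y^*c = y by rewrite !cstarM qs is_ cmulA.
have cy : corner q y by split; rewrite /y ?cmulA ?qq // -!cmulA qq.
apply: (corner_pos_antisym pq cy ys); first exact: projection_corner_pos (pF i ir).
pose r' := rem j (rem i r).
have jr' : j \in rem i r by rewrite mem_rem_uniq // inE jr andbT eq_sym.
have PE : q *c P *c q = y + (q + \sum_(k <- r') q *c F k *c q).
  rewrite -sumF cmul_sumr cmul_suml (big_rem i) //= (big_rem j) //=.
  by rewrite -/q -/y qq qq.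
have -> : - y = (q - q *c P *c q) + \sum_(k <- r') q *c F k *c q.
  rewrite PE; set S := \sum_(k <- r') _.
  by rewrite !opprD addrCA -!addrA addNr addr0 subrr addr0.
apply: corner_posD; first exact: coprojection_corner_pos.
apply: corner_pos_sum => k /mem_rem /mem_rem kr.
exact: projection_corner_pos (pF k kr).
Qed.

End CStarBasics.

(** * Cuntz-Krieger relations, *-homomorphisms and gauge actions *)

Section CuntzKrieger.
Variables (R : realType) (E : rf_digraph) (A : cstarAlgType R).
Implicit Types (e f : edge E) (v w : vertex E).

Lemma projection0 : is_projection (0 : A).
Proof. by split; rewrite ?cmul0 ?cstar0. Qed.

(** |x - x p|^2 is the norm of p - p - p + p. *)
Lemma mul_initial_projection (x p : A) :
  is_projection p -> x^*c *c x = p -> x *c p = x.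
Proof.
move=> [pp ps] xx; apply/eqP; rewrite eq_sym -subr_eq0; apply/eqP.
apply: star_mul_eq0.
have e1 : x^*c *c (x *c p) = p by rewrite cmulA xx pp.
have e2 : p *c x^*c *c x = p by rewrite -cmulA xx pp.
have e3 : p *c x^*c *c (x *c p) = p by rewrite cmulA e2 pp.
by rewrite cstarB cstarM ps !cmulBl !cmulBr xx e1 e2 e3 !subrr.
Qed.

(** The edges are automatically partial isometries, by
    [mul_initial_projection]. *)
Lemma ck_familyI (P : vertex E -> A) (S : edge E -> A) :
  (forall v, is_projection (P v)) ->
  (forall v w, v <> w -> P v *c P w = 0) ->
  (forall e, (S e)^*c *c S e = P (target e)) ->
  (forall v, ~ is_sink v ->
    \sum_(e \in [set e | source e = v]) (S e *c (S e)^*c) = P v) ->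
  ck_family P S.
Proof.
move=> pP oP tS sS; split => // e; rewrite /is_partial_isometry.
by rewrite -cmulA tS; apply: mul_initial_projection.
Qed.

Section Relations.
Variables (P : vertex E -> A) (S : edge E -> A).
Hypothesis ck : ck_family P S.

Lemma ck_mul_target e : S e *c P (target e) = S e.
Proof. exact: mul_initial_projection (ck_proj ck _) (ck_target ck e). Qed.

Lemma ck_range_projection e : is_projection (S e *c (S e)^*c).
Proof.
split; first by rewrite -cmulA (cmulA _ (S e)) (ck_target ck) cmulA ck_mul_target.
by rewrite cstarM cstarK.
Qed.

(** The range projections of the edges leaving one vertex add up to the
    projection of that vertex. *)
Lemma ck_range_orthogonal e f : source e = source f -> e != f ->
  (S e *c (S e)^*c) *c (S f *c (S f)^*c) = 0.
Proof.
move=> ef; have fin := row_finite (source f).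
have ns : ~ is_sink (source f) by move=> /(_ f).
have := ck_source ck ns; rewrite fsbig_finite // => sumP.
have orth := sum_projections_orthogonal
  (finmap.fset_uniq (fset_set [set e | source e = source f]))
  (fun e _ => ck_range_projection e) (ck_proj ck (source f)) sumP.
by apply: orth; rewrite in_fset_set // inE.
Qed.

Lemma ck_source_mul e : P (source e) *c S e = S e.
Proof.
have fin := row_finite (source e).
have ns : ~ is_sink (source e) by move=> /(_ e).
rewrite -(ck_source ck ns) fsbig_finite //= cmul_suml.
rewrite (big_rem e) /=; last by rewrite in_fset_set // inE.
rewrite (ck_piso ck e) big_seq big1 ?addr0 // => f.
rewrite (mem_rem_uniq _ (finmap.fset_uniq _)) => /andP[/= fe].
rewrite in_fset_set // inE => /= sf.
by rewrite -(ck_piso ck e) cmulA ck_range_orthogonal ?cmul0l.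
Qed.

Lemma ck_edges_orthogonal e f : e != f -> (S e)^*c *c S f = 0.
Proof.
move=> ef; have [sE|/eqP sN] := eqVneq (source e) (source f).
  have := congr1 (@cstar _ _) (ck_piso ck e); rewrite !cstarM cstarK => <-.
  rewrite -(ck_piso ck f) -cmulA (cmulA (S e *c _)).
  by rewrite ck_range_orthogonal // cmul0l cmul0.
rewrite -(ck_source_mul e) -(ck_source_mul f) cstarM.
have [_ ->] := ck_proj ck (source e).
by rewrite -cmulA (cmulA (P _)) (ck_orth ck) // cmul0l cmul0.
Qed.

End Relations.
End CuntzKrieger.

Section StarHom.
Variable R : realType.
Implicit Types A B D : cstarAlgType R.

Lemma star_hom_id A : star_hom (@id A).
Proof. by []. Qed.

Lemma star_hom_comp A B D (f : A -> B) (g : B -> D) :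
  star_hom f -> star_hom g -> star_hom (g \o f).
Proof.
move=> [fD fZ fM fS] [gD gZ gM gS]; split=> * /=.
- by rewrite fD gD.
- by rewrite fZ gZ.
- by rewrite fM gM.
- by rewrite fS gS.
Qed.

Lemma star_hom0 A B (f : A -> B) : star_hom f -> f 0 = 0.
Proof. by case=> fD _ _ _; apply: (addrI (f 0)); rewrite -fD !addr0. Qed.

Lemma star_hom_sum A B (f : A -> B) (I : Type) (r : seq I) (P : pred I)
    (F : I -> A) : star_hom f ->
  f (\sum_(i <- r | P i) F i) = \sum_(i <- r | P i) f (F i).
Proof. by move=> fh; exact: (big_morph f (star_homD fh) (star_hom0 fh)). Qed.

Lemma graph_hom_unique (E : rf_digraph) (A : graph_cstar R E) B
    (f g : A -> B) (P : vertex E -> B) (S : edge E -> B) :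
  ck_family P S -> star_hom f -> star_hom g ->
  (forall v, f (gP A v) = P v) -> (forall v, g (gP A v) = P v) ->
  (forall e, f (gS A e) = S e) -> (forall e, g (gS A e) = S e) -> f =1 g.
Proof.
move=> ck fh gh fP gP_ fS gS_ a; have [h [_ uh]] := g_universal A ck.
by rewrite -(uh f) // -(uh g).
Qed.

Lemma gauge_family (E : rf_digraph) A (P : vertex E -> A) (S : edge E -> A)
    (u : R[i]) : `|u| = 1 -> ck_family P S -> ck_family P (fun e => u *: S e).
Proof.
move=> u1 ck.
have uu : u * Num.conj u = 1 by rewrite -normCK u1 expr1n.
apply: ck_familyI.
- exact: (ck_proj ck).
- exact: (ck_orth ck).
- move=> e; rewrite cstarZ cmulZl cmulZr scalerA mulrC uu scale1r.
  exact: (ck_target ck).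
- move=> v /(ck_source ck) <-; apply: eq_fsbigr => e _.
  by rewrite cstarZ cmulZl cmulZr scalerA uu scale1r.
Qed.

(** Multiplying the edges by u preserves the Cuntz-Krieger relations, so
    universality provides the automorphisms; uniqueness makes them a group
    action. *)
Lemma gauge_action_exists (E : rf_digraph) (A : graph_cstar R E) :
  exists gamma, @gauge_action R E A gamma.
Proof.
have H (u : R[i]) : exists f : A -> A, `|u| = 1 -> [/\ star_hom f,
    forall v, f (gP A v) = gP A v & forall e, f (gS A e) = u *: gS A e].
  have [u1|u1] := eqVneq `|u| 1; last by exists id => /eqP; rewrite (negbTE u1).
  have [f [fh _]] := g_universal A (gauge_family u1 (g_family A)).
  by exists f.
have [gamma Hg] := choice H; exists gamma.
have n1 : `|1 : R[i]| = 1 by exact: normr1.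
split.
- by move=> u /Hg[].
- have [h P S] := Hg 1 n1.
  apply: (graph_hom_unique (gauge_family n1 (g_family A)) h (star_hom_id _)) => //.
  by move=> e; rewrite scale1r.
- move=> u v u1 v1; have uv1 : `|u * v| = 1 by rewrite normrM u1 v1 mulr1.
  have [h P S] := Hg _ uv1; have [hu Pu Su] := Hg _ u1; have [hv Pv Sv] := Hg _ v1.
  apply: (graph_hom_unique (gauge_family uv1 (g_family A)) h
    (star_hom_comp hv hu)) => //= [w|e]; first by rewrite Pv Pu.
  by rewrite Sv (star_homZ hu) Su scalerA mulrC.
- by move=> u v /Hg[_ P _]; exact: P.
- by move=> u e /Hg[_ _ S]; exact: S.
Qed.

End StarHom.

(** * The two Cuntz-Krieger families *)

Section FiniteSums.
Variables (V : nmodType) (n : nat).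

Lemma fsbig_finType (T : finType) (P : pred T) (D : set T) (F : T -> V) :
  (forall x, D x <-> P x) -> \sum_(x \in D) F x = \sum_(x | P x) F x.
Proof.
move=> DP; rewrite (@bigfs _ _ _ _ _ P F (index_enum_uniq T)); last first.
  by move=> i _; rewrite mem_index_enum.
by congr (\big[_/_]_(x \in _) _); apply/seteqP; split => x /DP.
Qed.

Lemma sigma_source_sum (F : 'I_n.+1 -> 'I_n.+1 -> V) (v : 'I_n.+1) :
  \sum_(e \in [set e : edge (Sigma n) | source e = v])
    F (val e).1 (val e).2 = \sum_(k < n.+1 | (v <= k)%N) F v k.
Proof.
rewrite (fsbig_finType (P := fun e : sigma_edge n => (val e).1 == v)); last first.
  by move=> e; split=> [<-|/eqP]; rewrite ?eqxx.
pose A := [pred ij : 'I_n.+1 * 'I_n.+1 | (ij.1 <= ij.2)%N].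
rewrite -(big_sub_cond A (fun ij => ij.1 == v) (fun ij => F ij.1 ij.2)).
rewrite (eq_bigl (fun ij : 'I_n.+1 * 'I_n.+1 => (ij.1 == v) && (ij.1 <= ij.2)%N)); last first.
  by move=> ij; rewrite andbC.
by rewrite -(pair_big_dep (fun i => i == v)
  (fun i (k : 'I_n.+1) => (i <= k)%N) F) big_pred1_eq.
Qed.

Lemma sigmat_source_sum (F : sigmat_edge n -> V) (v : 'I_n.+1) :
  \sum_(e \in [set e : edge (Sigmat n) | source e = v]) F e =
  F (inl v) + \sum_(j < n | widen_ord (leqnSn n) j == v) F (inr j).
Proof.
rewrite (fsbig_finType (P := fun e : sigmat_edge n => sigmat_source e == v)).
  by rewrite big_sumType /= big_pred1_eq.
by move=> e; split=> [<-|/eqP]; rewrite ?eqxx.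
Qed.

End FiniteSums.

Section SigmaRelations.
Variables (R : realType) (n : nat) (A : graph_cstar R (Sigma n)).
Implicit Types i j k : 'I_n.+1.
Let ck := g_family A.

Lemma Se_edge i j (ij : (i <= j)%N) :
  Se A i j = gS A (Sub (i, j) ij : edge (Sigma n)).
Proof. by rewrite /Se insubT. Qed.

Lemma gS_Se (e : edge (Sigma n)) : gS A e = Se A (val e).1 (val e).2.
Proof. by rewrite /Se -surjective_pairing valK. Qed.

Lemma Se_target i j : (i <= j)%N -> (Se A i j)^*c *c Se A i j = gP A j.
Proof. by move=> ij; rewrite (Se_edge ij) (ck_target ck). Qed.

Lemma Se_mul_target i j : (i <= j)%N -> Se A i j *c gP A j = Se A i j.
Proof. by move=> ij; rewrite (Se_edge ij) -[RHS](ck_mul_target ck). Qed.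

Lemma Se_orthogonal i j k : (i <= j)%N -> (i <= k)%N -> j != k ->
  (Se A i j)^*c *c Se A i k = 0.
Proof.
move=> ij ik jk; rewrite (Se_edge ij) (Se_edge ik).
by apply: (ck_edges_orthogonal ck); rewrite -val_eqE /= xpair_eqE eqxx.
Qed.

Lemma Se_source i :
  \sum_(k < n.+1 | (i <= k)%N) Se A i k *c (Se A i k)^*c = gP A i.
Proof.
rewrite -(ck_source ck); last by move=> /(_ (Sub (i, i) (leqnn i))).
rewrite -(sigma_source_sum (fun i k => Se A i k *c (Se A i k)^*c)).
by apply: eq_fsbigr => e _; rewrite gS_Se.
Qed.

Definition Sf_image (j : 'I_n) : A := \sum_(k < n.+1 | (j < k)%N)
  Se A (widen_ord (leqnSn n) j) k *c (Se A (lift ord0 j) k)^*c.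

(** All summands but the k-th are killed by orthogonality of distinct edges. *)
Lemma Sf_image_mul (j : 'I_n) k : (j < k)%N ->
  Sf_image j *c Se A (lift ord0 j) k = Se A (widen_ord (leqnSn n) j) k.
Proof.
move=> jk; rewrite /Sf_image cmul_suml (bigD1 k) //= -cmulA Se_target ?lift0 //.
rewrite Se_mul_target ?(ltnW jk) // big1 ?addr0 // => l /andP[jl lk].
by rewrite -cmulA Se_orthogonal ?lift0 ?cmul0.
Qed.

Lemma Sf_image_target (j : 'I_n) :
  (Sf_image j)^*c *c Sf_image j = gP A (lift ord0 j).
Proof.
rewrite {2}/Sf_image cmul_sumr -Se_source; apply: eq_big => [k|k jk].
  by rewrite lift0.
rewrite cmulA; congr (_ *c _).
rewrite /Sf_image cstar_sum cmul_suml (bigD1 k) //= cstarM cstarK.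
rewrite -cmulA Se_target ?(ltnW jk) // Se_mul_target ?lift0 //.
rewrite big1 ?addr0 // => l /andP[jl lk].
by rewrite cstarM -cmulA Se_orthogonal ?cmul0 // ltnW.
Qed.

Lemma Sf_image_range (j : 'I_n) : Sf_image j *c (Sf_image j)^*c =
  \sum_(k < n.+1 | (j < k)%N)
    Se A (widen_ord (leqnSn n) j) k *c (Se A (widen_ord (leqnSn n) j) k)^*c.
Proof.
rewrite {2}/Sf_image cstar_sum cmul_sumr; apply: eq_bigr => k jk.
by rewrite cstarM cstarK cmulA Sf_image_mul.
Qed.

Definition Sigmat_image (e : edge (Sigmat n)) : A :=
  match e with inl i => Se A i i | inr j => Sf_image j end.

Lemma Sigmat_image_family :
  @ck_family R (Sigmat n) A (gP A) Sigmat_image.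
Proof.
apply: ck_familyI.
- exact: (ck_proj ck).
- exact: (ck_orth ck).
- by case=> [i|j]; [exact: Se_target | exact: Sf_image_target].
- move=> v _; rewrite sigmat_source_sum /= -Se_source (bigD1 v) //=.
  congr (_ + _).
  have [vn|nv] := ltnP v n.
    rewrite (big_pred1 (Ordinal vn)); last first.
      by move=> j /=; rewrite -!val_eqE.
    rewrite Sf_image_range (_ : widen_ord _ _ = v); last exact: val_inj.
    by apply: eq_bigl => k /=; rewrite ltn_neqAle andbC -val_eqE eq_sym.
  rewrite !big1 // => [k /andP[vk kv]|j /eqP vj].
    have := ltn_ord k; have : (v < k)%N by rewrite ltn_neqAle eq_sym kv.
    by lia.
  by move: nv; rewrite -vj /= leqNgt ltn_ord.
Qed.

End SigmaRelations.

Section SigmatRelations.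
Variables (R : realType) (n : nat) (A : graph_cstar R (Sigmat n)).
Implicit Types i j k : 'I_n.+1.
Let ck := g_family A.

Lemma Spath_diag k : Spath A k k = Sloop A k.
Proof.
rewrite /Spath (eq_filter (a2 := pred0)) ?filter_pred0 // => i /=.
by apply/negbTE; lia.
Qed.

Lemma iota_filter a b m : (b <= m)%N ->
  [seq i <- iota 0 m | (a <= i < b)%N] = iota a (b - a).
Proof.
move=> bm; apply: (irr_sorted_eq ltn_trans ltnn).
- by apply: sorted_filter; [exact: ltn_trans | exact: iota_ltn_sorted].
- exact: iota_ltn_sorted.
- by move=> i; rewrite mem_filter !mem_iota; lia.
Qed.

(** The indices of the fold form the interval from j to k - 1, whose first
    element is split off. *)
Lemma Spath_cons (j : 'I_n) k : (j < k)%N ->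
  Spath A (widen_ord (leqnSn n) j) k = Sf A j *c Spath A (lift ord0 j) k.
Proof.
move=> jk; rewrite /Spath.
have kn : (k <= n)%N by rewrite -ltnS.
have -> : [seq i : 'I_n <- enum 'I_n | (widen_ord (leqnSn n) j <= i < k)%N] =
    j :: [seq i : 'I_n <- enum 'I_n | (lift ord0 j <= i < k)%N].
  have E (c : nat) : map (@nat_of_ord n) [seq l : 'I_n <- enum 'I_n | (c <= l < k)%N]
      = iota c (k - c).
    by rewrite -(filter_map (@nat_of_ord n) (fun l : nat => c <= l < k)%N) val_enum_ord
      iota_filter.
  apply: (inj_map (@ord_inj n)); rewrite /= (E j) (E (bump 0 j)).
  by rewrite -(subnSK jk) /= /bump leq0n add1n.
by [].
Qed.

Lemma source_mul_Spath j k : (j <= k)%N ->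
  gP A j *c Spath A j k = Spath A j k.
Proof.
rewrite leq_eqVlt => /orP[/eqP/val_inj <-|jk].
  by rewrite Spath_diag -[RHS](ck_source_mul ck).
have jn : (j < n)%N by have := ltn_ord k; lia.
have -> : j = widen_ord (leqnSn n) (Ordinal jn) by exact: val_inj.
rewrite Spath_cons // cmulA; congr (_ *c _).
by rewrite -[RHS](ck_source_mul ck).
Qed.

Lemma Sf_target (j : 'I_n) : (Sf A j)^*c *c Sf A j = gP A (lift ord0 j).
Proof. exact: (ck_target ck). Qed.

Lemma Sf_mul_target (j : 'I_n) : Sf A j *c gP A (lift ord0 j) = Sf A j.
Proof. by rewrite -[RHS](ck_mul_target ck). Qed.

Lemma Sigmat_source_relation j :
  Sloop A j *c (Sloop A j)^*c +
  \sum_(i < n | widen_ord (leqnSn n) i == j) Sf A i *c (Sf A i)^*c = gP A j.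
Proof.
rewrite -(ck_source ck); last by move=> /(_ (inl j)).
by rewrite sigmat_source_sum.
Qed.

Lemma last_or_widen j : j = ord_max \/ exists i : 'I_n, j = widen_ord (leqnSn n) i.
Proof.
have [jn|nj] := ltnP j n; last by left; apply: val_inj => /=; have := ltn_ord j; lia.
by right; exists (Ordinal jn); exact: val_inj.
Qed.

Lemma ord_descending_ind (Q : 'I_n.+1 -> Prop) : Q ord_max ->
  (forall i : 'I_n, Q (lift ord0 i) -> Q (widen_ord (leqnSn n) i)) ->
  forall j, Q j.
Proof.
move=> Qn Qs j; have [m] := ubnP (n - j)%N; elim: m j => // m IH j jm.
have [->//|[i ji]] := last_or_widen j; rewrite ji; apply/Qs/IH.
by move: jm; rewrite ji lift0 /=; have := ltn_ord i; lia.
Qed.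

Lemma Spath_target j k : (j <= k)%N ->
  (Spath A j k)^*c *c Spath A j k = gP A k.
Proof.
elim/ord_descending_ind: j k => [k nk|i IH k].
  have -> : k = ord_max by apply: val_inj => /=; move: nk (ltn_ord k) => /=; lia.
  by rewrite Spath_diag; exact: (ck_target ck).
rewrite leq_eqVlt => /orP[/eqP/val_inj <-|ik].
  by rewrite Spath_diag; exact: (ck_target ck).
have ik' : (lift ord0 i <= k)%N by rewrite lift0.
rewrite Spath_cons // cstarM -cmulA (cmulA _ (Sf A i)) Sf_target.
by rewrite source_mul_Spath // IH.
Qed.

(** At each step the loop e_j contributes its range projection, and the other
    summands are the conjugates by S_{f_j} of the summands at j + 1, whose total
    is S_{f_j} P_{w_{j+1}} S_{f_j}^* = S_{f_j} S_{f_j}^*. *)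
Lemma Spath_source j :
  \sum_(k < n.+1 | (j <= k)%N) Spath A j k *c (Spath A j k)^*c = gP A j.
Proof.
elim/ord_descending_ind: j => [|i IH]; rewrite -Sigmat_source_relation.
  rewrite (big_pred1 ord_max) ?Spath_diag; last first.
    by move=> k /=; rewrite -val_eqE /=; have := ltn_ord k; lia.
  rewrite big1 ?addr0 // => i /eqP/(congr1 val) /=.
  by have := ltn_ord i; lia.
rewrite (bigD1 (widen_ord (leqnSn n) i)) //= Spath_diag; congr (_ + _).
rewrite (big_pred1 i); last by move=> l /=; rewrite -!val_eqE.
rewrite -{1}(Sf_mul_target i) -IH cmul_sumr cmul_suml.
apply: eq_big => [k|k /andP[ik ki]].
  by rewrite lift0 -val_eqE /= [RHS]ltn_neqAle andbC eq_sym.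
have ik' : (i < k)%N by move: ki ik; rewrite -val_eqE /=; lia.
by rewrite Spath_cons // cstarM !cmulA.
Qed.

Lemma Sf_mul_Spath_sum (j : 'I_n) :
  \sum_(k < n.+1 | (j < k)%N)
    Spath A (widen_ord (leqnSn n) j) k *c (Spath A (lift ord0 j) k)^*c = Sf A j.
Proof.
rewrite -[RHS]Sf_mul_target -Spath_source cmul_sumr.
apply: eq_big => [k|k jk]; first by rewrite lift0.
by rewrite Spath_cons // cmulA.
Qed.

Definition Sigma_image (e : edge (Sigma n)) : A := Spath A (val e).1 (val e).2.

Lemma Sigma_image_family : @ck_family R (Sigma n) A (gP A) Sigma_image.
Proof.
apply: ck_familyI.
- exact: (ck_proj ck).
- exact: (ck_orth ck).
- by move=> [[i j] ij]; exact: Spath_target.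
- move=> v _; rewrite -Spath_source.
  exact: (sigma_source_sum (fun i k => Spath A i k *c (Spath A i k)^*c)).
Qed.

End SigmatRelations.

(** * The C*-algebra of bounded infinite matrices *)

Section Forms.
Variable R : realType.
Local Notation C := R[i].
Implicit Types (x y u v : nat -> C) (a b : nat -> nat -> C) (M : C).

Definition normsq N x : C := \sum_(i < N) `|x i| ^+ 2.

Definition form a K N x y : C :=
  \sum_(i < K) \sum_(j < N) y i * a i j * x j.

(** For the least M this is the operator norm of the matrix a: by homogeneity
    in x and y the bound is equivalent to |<a x, y>| <= M |x| |y|.  Being linear
    in a and in M, in this form it is stable under sums, adjoints and limits,
    and no square roots occur. *)
Definition form_bounded M a := forall K N x y,
  2 * `|form a K N x y| <= M * (normsq N x + normsq K y).

Definition apply_mx a N x i : C := \sum_(j < N) a i j * x j.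

Lemma normsq_ge0 N x : 0 <= normsq N x.
Proof. by apply: sumr_ge0 => i _; rewrite exprn_ge0. Qed.

Lemma normsqZ N (c : C) x : normsq N (fun i => c * x i) = `|c| ^+ 2 * normsq N x.
Proof.
by rewrite /normsq mulr_sumr; apply: eq_bigr => i _; rewrite normrM exprMn.
Qed.

Lemma normsqC N x : normsq N (fun i => (x i)^*%C) = normsq N x.
Proof. by apply: eq_bigr => i _; rewrite normcJ. Qed.

Lemma amgm (p q t : C) : 0 < t ->
  2 * `|p * q| <= t * `|p| ^+ 2 + t^-1 * `|q| ^+ 2.
Proof.
move=> t0; have tr : t \is Num.real by rewrite ger0_real // ltW.
rewrite -subr_ge0.
have -> : t * `|p| ^+ 2 + t^-1 * `|q| ^+ 2 - 2 * `|p * q| =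
    t^-1 * (t * `|p| - `|q|) ^+ 2.
  by rewrite normrM; field; rewrite gt_eqF.
apply: mulr_ge0; first by rewrite invr_ge0 ltW.
by rewrite real_exprn_even_ge0 // realB // ?realM // normr_real.
Qed.

Lemma sum_amgm N x y (t : C) : 0 < t ->
  2 * `|\sum_(i < N) x i * y i| <= t * normsq N x + t^-1 * normsq N y.
Proof.
move=> t0; rewrite /normsq !mulr_sumr -big_split /=.
apply: le_trans (_ : \sum_(i < N) 2 * `|x i * y i| <= _).
  by rewrite -mulr_sumr ler_wpM2l // ler_norm_sum.
by apply: ler_sum => i _; exact: amgm.
Qed.

Lemma formE a K N x y : form a K N x y = \sum_(i < K) y i * apply_mx a N x i.
Proof.
apply: eq_bigr => i _; rewrite /apply_mx mulr_sumr.
by apply: eq_bigr => j _; rewrite mulrA.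
Qed.

Lemma form_boundedW M M' a : M <= M' -> form_bounded M a -> form_bounded M' a.
Proof.
move=> MM aM K N x y; apply: le_trans (aM K N x y) _.
by rewrite ler_wpM2r // addr_ge0 // normsq_ge0.
Qed.

Lemma form_bounded_epsilon M a :
  (forall e : C, 0 < e -> form_bounded (M + e) a) -> form_bounded M a.
Proof.
move=> h K N x y; apply: lec_epsilon => e e0.
have S0 : 0 <= normsq N x + normsq K y by rewrite addr_ge0 // normsq_ge0.
have S1 : 0 < normsq N x + normsq K y + 1 by rewrite ltr_wpDl.
have e1 : 0 < e / (normsq N x + normsq K y + 1) by rewrite divr_gt0.
apply: le_trans (h _ e1 K N x y) _; rewrite mulrDl lerD2l.
rewrite mulrAC ler_pdivrMr // ler_wpM2l ?(ltW e0) // lerDl //.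
Qed.

Lemma formD a b K N x y :
  form (fun i j => a i j + b i j) K N x y = form a K N x y + form b K N x y.
Proof.
rewrite /form -big_split; apply: eq_bigr => i _ /=.
by rewrite -big_split; apply: eq_bigr => j _ /=; rewrite mulrDr mulrDl.
Qed.

Lemma formZ c a K N x y :
  form (fun i j => c * a i j) K N x y = c * form a K N x y.
Proof.
rewrite /form mulr_sumr; apply: eq_bigr => i _ /=.
by rewrite mulr_sumr; apply: eq_bigr => j _ /=; rewrite !mulrA (mulrC (y i)).
Qed.

Lemma form_tr a K N x y :
  form (fun i j => a j i) K N x y = form a N K y x.
Proof.
rewrite /form exchange_big /=; apply: eq_bigr => i _; apply: eq_bigr => j _.
by rewrite mulrC mulrA mulrAC mulrC mulrA.
Qed.

Lemma formC a K N x y :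
  form (fun i j => (a i j)^*%C) K N x y =
  (form a K N (fun i => (x i)^*%C) (fun i => (y i)^*%C))^*%C.
Proof.
rewrite /form rmorph_sum; apply: eq_bigr => i _ /=.
rewrite rmorph_sum; apply: eq_bigr => j _ /=.
by rewrite !rmorphM /= !conjcK.
Qed.

Lemma form_boundedD M M' a b : form_bounded M a -> form_bounded M' b ->
  form_bounded (M + M') (fun i j => a i j + b i j).
Proof.
move=> aM bM K N x y; rewrite formD (mulrDl M).
apply: (le_trans _ (lerD (aM K N x y) (bM K N x y))).
by rewrite -mulrDr ler_wpM2l // ler_normD.
Qed.

Lemma form_boundedZ M c a : form_bounded M a ->
  form_bounded (`|c| * M) (fun i j => c * a i j).
Proof.
move=> aM K N x y; rewrite formZ normrM mulrCA -mulrA.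
by rewrite ler_wpM2l.
Qed.

Lemma form_bounded_tr M a : form_bounded M a -> form_bounded M (fun i j => a j i).
Proof. by move=> aM K N x y; rewrite form_tr addrC. Qed.

Lemma form_bounded_conj M a : form_bounded M a ->
  form_bounded M (fun i j => (a i j)^*%C).
Proof.
by move=> aM K N x y; rewrite formC normcJ -(normsqC N) -(normsqC K).
Qed.

(** Take y proportional to the conjugate of a x, with factor 1/M. *)
Lemma form_bounded_apply M a K N x : 0 < M -> form_bounded M a ->
  normsq K (apply_mx a N x) <= M ^+ 2 * normsq N x.
Proof.
move=> M0 aM; set S := normsq K _.
have := aM K N x (fun i => M^-1 * (apply_mx a N x i)^*%C).
rewrite formE normsqZ normsqC -/S.
have -> : \sum_(i < K) M^-1 * (apply_mx a N x i)^*%C * apply_mx a N x i = M^-1 * S.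
  rewrite /S mulr_sumr; apply: eq_bigr => i _.
  by rewrite -mulrA sqr_normc (mulrC (_^*%C)).
have S0 : 0 <= S by apply: normsq_ge0.
rewrite ger0_norm; last by rewrite mulr_ge0 // invr_ge0 ltW.
rewrite (ger0_norm (_ : 0 <= M^-1)) ?invr_ge0 ?(ltW M0) // => h.
have : M * (2 * (M^-1 * S)) <= M * (M * (normsq N x + M^-1 ^+ 2 * S)).
  by rewrite ler_pM2l.
have -> : M * (2 * (M^-1 * S)) = S + S by field; rewrite gt_eqF.
have -> : M * (M * (normsq N x + M^-1 ^+ 2 * S)) = M ^+ 2 * normsq N x + S.
  by field; rewrite gt_eqF.
by rewrite lerD2r.
Qed.

Lemma apply_delta a j i : apply_mx a j.+1 (fun l => (l == j)%:R) i = a i j.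
Proof.
rewrite /apply_mx big_ord_recr /= eqxx mulr1 big1 ?add0r // => k _.
by rewrite ltn_eqF ?mulr0.
Qed.

Lemma normsq_delta j : normsq j.+1 (fun l => (l == j)%:R) = 1.
Proof.
rewrite /normsq big_ord_recr /= eqxx normr1 expr1n big1 ?add0r // => k _.
by rewrite ltn_eqF // normr0 expr0n.
Qed.

Definition square_summable u := exists U : C, forall N, normsq N u <= U.

Lemma form_bounded_col M a j : 0 < M -> form_bounded M a ->
  square_summable (fun i => a i j).
Proof.
move=> M0 aM; exists (M ^+ 2) => N.
have := form_bounded_apply N j.+1 (fun l => (l == j)%:R) M0 aM.
rewrite normsq_delta mulr1; apply: le_trans.
by rewrite le_eqVlt; apply/orP; left; apply/eqP/eq_bigr => i _; rewrite apply_delta.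
Qed.

Lemma form_bounded_row M a i : 0 < M -> form_bounded M a ->
  square_summable (a i).
Proof. by move=> M0 /form_bounded_tr; exact: form_bounded_col. Qed.

Lemma form_bounded_entry M a i j : form_bounded M a -> `|a i j| <= M.
Proof.
move=> /(_ i.+1 j.+1 (fun l => (l == j)%:R) (fun l => (l == i)%:R)).
rewrite !normsq_delta formE.
rewrite (eq_bigr (fun k : 'I__ => a k j * ((k : nat) == i)%:R)); last first.
  by move=> k _; rewrite apply_delta mulrC.
rewrite -/(apply_mx (fun _ k => a k j) i.+1 (fun l => (l == i)%:R) 0%N).
by rewrite apply_delta -mulr2n [M * _]mulrC ler_pM2l // ltr0n.
Qed.

Lemma normsqS N u : normsq N.+1 u = normsq N u + `|u N| ^+ 2.
Proof. by rewrite /normsq big_ord_recr. Qed.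

Lemma normsq_mono u N K : (N <= K)%N -> normsq N u <= normsq K u.
Proof.
elim: K => [|K IH]; first by rewrite leqn0 => /eqP ->.
rewrite leq_eqVlt => /orP[/eqP -> //|]; rewrite ltnS => /IH.
by move=> /le_trans; apply; rewrite normsqS lerDl exprn_ge0.
Qed.

(** The tails of a convergent series are small: the partial sums come within e
    of their supremum. *)
Lemma square_summable_tail u : square_summable u -> forall e : C, 0 < e ->
  exists N0, forall N, normsq N u <= normsq N0 u + e.
Proof.
move=> [U uU] e e0; have [r r0 ->] := gtc0P e0.
pose s N := Re (normsq N u).
have sE N : normsq N u = (s N)%:C.
  by have [q _ E] := gec0P (normsq_ge0 N u); rewrite /s E.
have U0 : 0 <= U by apply: le_trans (uU 0); exact: normsq_ge0.
have [V _ VE] := gec0P U0.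
have hs : has_sup (range s).
  split; first by exists (s 0); exists 0.
  by exists V => _ [N _ <-]; rewrite -lecR -sE -VE.
have [_ [N0 _ <-] lt] := sup_adherent r0 hs.
exists N0 => N; rewrite !sE -rmorphD lecR.
have : s N <= sup (range s) by apply: sup_upper_bound => //; exists N.
move: lt; lra.
Qed.

End Forms.

Section Sequences.
Variable R : realType.
Local Notation C := R[i].
Local Notation "s ~> l" := ((s : nat -> C^o) @ \oo --> (l : C^o)) (at level 70).
Implicit Types (s t : nat -> C) (l m c : C).

Lemma clim_le s l : s ~> l <->
  forall e : C, 0 < e -> exists N0, forall N, (N0 <= N)%N -> `|l - s N| <= e.
Proof.
split=> [/cvgrPdist_le sl e /sl [N0 _ H]|H]; first by exists N0.
by apply/cvgrPdist_le => e /H [N0 {}H]; exists N0.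
Qed.

Section Filters.
Context (T : Type) (F : set_system T) {FF : Filter F}.
Implicit Types (f g : T -> C^o) (p q : C^o).

Lemma climD f g p q : f @ F --> p -> g @ F --> q ->
  (fun z => f z + g z) @ F --> (p + q).
Proof. exact: cvgD. Qed.

Lemma climZ (c : C) f p : f @ F --> p -> (fun z => c * f z : C^o) @ F --> (c * p : C^o).
Proof. exact: (cvgMl_tmp (a := c : C^o)). Qed.

Lemma clim_cst p : (fun=> p) @ F --> p.
Proof. exact: cvg_cst. Qed.

Lemma clim_sum (K : nat) (f : nat -> T -> C^o) (g : nat -> C^o) :
  (forall k, f k @ F --> g k) ->
  (fun z => \sum_(k < K) f k z) @ F --> \sum_(k < K) g k.
Proof.
move=> fg; elim: K => [|K IH].
  by rewrite big_ord0; under eq_fun do rewrite big_ord0; exact: clim_cst.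
rewrite big_ord_recr /=; under eq_fun do rewrite big_ord_recr /=.
exact: (climD IH (fg K)).
Qed.

End Filters.

Lemma clim_conj s l : s ~> l -> (fun N => (s N)^*%C) ~> l^*%C.
Proof.
move=> /clim_le sl; apply/clim_le => e /sl [N0 H].
by exists N0 => N /H; rewrite -rmorphB normcJ.
Qed.

Lemma clim_normsq K (f : nat -> nat -> C) (g : nat -> C) :
  (forall k, f k ~> g k) -> (fun N => normsq K (f ^~ N)) ~> normsq K g.
Proof.
move=> fg; apply: (clim_sum (f := fun k N => `|f k N| ^+ 2)
  (g := fun k => `|g k| ^+ 2)) => k.
have -> : (fun N => `|f k N| ^+ 2) = (fun N => f k N * (f k N)^*%C).
  by apply/funext => N; rewrite sqr_normc.
rewrite sqr_normc.
exact: (cvgM (fg k) (clim_conj (fg k))).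
Qed.

Lemma clim_eventually N0 s t l :
  (forall N, (N0 <= N)%N -> s N = t N) -> s ~> l -> t ~> l.
Proof.
move=> st /clim_le sl; apply/clim_le => e /sl [N1 H].
exists (maxn N0 N1) => N; rewrite geq_max => /andP[h1 h2].
by rewrite -st // H.
Qed.

Lemma normsq_lim_le K (f : nat -> nat -> C) (g : nat -> C) (B : C) :
  (forall k, f k ~> g k) -> (exists N0, forall N, (N0 <= N)%N ->
    normsq K (f ^~ N) <= B) -> normsq K g <= B.
Proof.
move=> fg [N0 H]; rewrite -(ger0_norm (normsq_ge0 K g)).
apply: norm_lim_le (clim_normsq (K := K) fg) _; exists N0 => // N /H.
by rewrite /= ger0_norm // normsq_ge0.
Qed.

End Sequences.

Section Dot.
Variable R : realType.
Local Notation C := R[i].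
Local Notation "s ~> l" := ((s : nat -> C^o) @ \oo --> (l : C^o)) (at level 70).
Implicit Types (x y u v : nat -> C) (a b : nat -> nat -> C) (M : C).

Definition partial_dot u v N : C := \sum_(k < N) u k * v k.

(** The bilinear (not sesquilinear) product, so that entries of matrix
    products are values of [dot]. *)
Definition dot u v : C := lim ((partial_dot u v : nat -> C^o) @ \oo).

Lemma partial_dotS u v N :
  partial_dot u v N.+1 = partial_dot u v N + u N * v N.
Proof. by rewrite /partial_dot big_ord_recr. Qed.

Lemma partial_dot_tail u v N K : (N <= K)%N ->
  2 * `|partial_dot u v K - partial_dot u v N| <=
  (normsq K u - normsq N u) + (normsq K v - normsq N v).
Proof.
elim: K => [|K IH].
  by rewrite leqn0 => /eqP ->; rewrite !subrr normr0 mulr0 addr0.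
rewrite leq_eqVlt => /orP[/eqP <-|]; first by rewrite !subrr normr0 mulr0 addr0.
rewrite ltnS => /IH {}IH; rewrite partial_dotS !normsqS.
have := amgm (u K) (v K) ltr01; rewrite invr1 !mul1r => H.
have := lerD IH H.
rewrite -mulrDr => /(le_trans _) h.
apply: le_trans (h _ _) _.
  by rewrite ler_wpM2l // [X in `|X|]addrAC ler_normD.
by rewrite le_eqVlt; apply/orP; left; apply/eqP; ring.
Qed.

Lemma dot_cvg u v : square_summable u -> square_summable v ->
  partial_dot u v ~> dot u v.
Proof.
move=> su sv; apply: complex_complete; apply: cauchy_exP => e e0.
have e2 : 0 < e / 2 by rewrite divr_gt0.
have [N1 h1] := square_summable_tail su e2.
have [N2 h2] := square_summable_tail sv e2.
pose N0 := maxn N1 N2.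
exists (partial_dot u v N0); exists N0 => // N /= N0N.
rewrite /ball /= distrC.
have h := partial_dot_tail u v N0N.
have {}h1 : normsq N u - normsq N0 u <= e / 2.
  rewrite lerBlDl (le_trans (h1 N)) // lerD2r normsq_mono //.
  exact: leq_maxl.
have {}h2 : normsq N v - normsq N0 v <= e / 2.
  rewrite lerBlDl (le_trans (h2 N)) // lerD2r normsq_mono //.
  exact: leq_maxr.
have := le_trans h (lerD h1 h2).
rewrite -splitr -ler_pdivlMl // mulrC => /le_lt_trans; apply.
by rewrite ltr_pdivrMr // mulr_natr mulr2n ltrDl.
Qed.

Lemma dot_eq u v l : partial_dot u v ~> l -> dot u v = l.
Proof. exact: cvg_lim. Qed.

Lemma dotC u v : dot u v = dot v u.
Proof.
rewrite /dot (_ : partial_dot u v = partial_dot v u) //; apply/funext => N.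
by apply: eq_bigr => k _; rewrite mulrC.
Qed.

Lemma partial_dotDl u u' v N :
  partial_dot (fun k => u k + u' k) v N = partial_dot u v N + partial_dot u' v N.
Proof. by rewrite -big_split; apply: eq_bigr => k _; rewrite mulrDl. Qed.

Lemma partial_dotZl c u v N :
  partial_dot (fun k => c * u k) v N = c * partial_dot u v N.
Proof. by rewrite [RHS]mulr_sumr; apply: eq_bigr => k _; rewrite mulrA. Qed.

Lemma dotDl u u' v : square_summable u -> square_summable u' ->
  square_summable v -> dot (fun k => u k + u' k) v = dot u v + dot u' v.
Proof.
move=> su su' sv; apply: dot_eq; rewrite (funext (partial_dotDl u u' v)).
by apply: climD; exact: dot_cvg.
Qed.

Lemma dotZl c u v : square_summable u -> square_summable v ->
  dot (fun k => c * u k) v = c * dot u v.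
Proof.
move=> su sv; apply: dot_eq; rewrite (funext (partial_dotZl c u v)).
by apply: climZ; exact: dot_cvg.
Qed.

Lemma dot_conj u v : square_summable u -> square_summable v ->
  dot (fun k => (u k)^*%C) (fun k => (v k)^*%C) = (dot u v)^*%C.
Proof.
move=> su sv; apply: dot_eq.
have -> : partial_dot (fun k => (u k)^*%C) (fun k => (v k)^*%C) =
    fun N => (partial_dot u v N)^*%C.
  apply/funext => N; rewrite [RHS]rmorph_sum; apply: eq_bigr => k _.
  by rewrite rmorphM.
by apply: clim_conj; exact: dot_cvg.
Qed.

Lemma dot_le u v (U V t : C) : 0 < t ->
  square_summable u -> square_summable v ->
  (forall N, normsq N u <= U) -> (forall N, normsq N v <= V) ->
  2 * `|dot u v| <= t * U + t^-1 * V.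
Proof.
move=> t0 su sv uU vV; rewrite mulrC -ler_pdivlMr //.
apply: norm_lim_le (dot_cvg su sv) _; exists 0%N => // N _.
rewrite /= ler_pdivlMr // mulrC (le_trans (sum_amgm _ _ _ t0)) //.
by rewrite lerD // ler_wpM2l // ?invr_ge0 ltW.
Qed.

Lemma clim_dot_sum K (f : nat -> nat -> C) u (c : nat -> C) :
  (forall i, square_summable (f i)) -> square_summable u ->
  (fun N => partial_dot u (fun k => \sum_(i < K) c i * f i k) N) ~>
  (\sum_(i < K) c i * dot u (f i)).
Proof.
move=> sf su.
have -> : (fun N => partial_dot u (fun k => \sum_(i < K) c i * f i k) N) =
    fun N => \sum_(i < K) c i * partial_dot u (f i) N.
  apply/funext => N; rewrite /partial_dot.
  under eq_bigr do rewrite mulr_sumr.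
  rewrite exchange_big; apply: eq_bigr => i _; rewrite mulr_sumr.
  by apply: eq_bigr => k _; rewrite mulrCA.
apply: (clim_sum (f := fun i N => c i * partial_dot u (f i) N)
  (g := fun i => c i * dot u (f i))) => i.
by apply: climZ; exact: dot_cvg.
Qed.

Definition tail N v k : C := if (k < N)%N then 0 else v k.

Lemma apply_tail a N L v k : (N <= L)%N ->
  apply_mx a L v k = apply_mx a N v k + apply_mx a L (tail N v) k.
Proof.
elim: L => [|L IH].
  by rewrite leqn0 => /eqP ->; rewrite /apply_mx !big_ord0 addr0.
rewrite leq_eqVlt => /orP[/eqP <-|].
  rewrite [X in _ + X]big1 ?addr0 // => j _.
  by rewrite /tail ltn_ord mulr0.
rewrite ltnS => NL; rewrite /apply_mx !big_ord_recr /= -!/(apply_mx _ _ _ _).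
by rewrite (IH NL) addrA /tail ltnNge NL.
Qed.

Lemma normsq_tail N L v : normsq L (tail N v) = normsq (maxn N L) v - normsq N v.
Proof.
elim: L => [|L IH]; first by rewrite maxn0 subrr /normsq big_ord0.
rewrite normsqS IH /tail; case: ltnP => NL.
  by rewrite normr0 expr0n addr0 (maxn_idPl _) ?(maxn_idPl _) // ltnW.
by rewrite (maxn_idPr (leqW NL)) normsqS; ring.
Qed.

Section Assoc.
Variables (M : C) (b : nat -> nat -> C).
Hypotheses (M0 : 0 < M) (bM : form_bounded M b).

Lemma dot_apply_cvg v k : square_summable v ->
  (fun N => apply_mx b N v k) ~> dot (b k) v.
Proof. by move=> sv; apply: dot_cvg => //; exact: form_bounded_row bM. Qed.

Lemma normsq_dot_le v V K : (forall N, normsq N v <= V) ->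
  normsq K (fun k => dot (b k) v) <= M ^+ 2 * V.
Proof.
move=> vV; apply: (normsq_lim_le (f := fun k N => apply_mx b N v k)).
  by move=> k; apply: dot_apply_cvg; exists V.
exists 0 => N _; apply: le_trans (form_bounded_apply K N v M0 bM) _.
by rewrite ler_wpM2l // exprn_ge0 // ltW.
Qed.

Lemma square_summable_dot v : square_summable v ->
  square_summable (fun k => dot (b k) v).
Proof. by case=> V vV; exists (M ^+ 2 * V) => N; exact: normsq_dot_le. Qed.

Lemma square_summable_tail_seq N v : square_summable v ->
  square_summable (tail N v).
Proof.
case=> V vV; exists V => L; rewrite normsq_tail.
by rewrite (le_trans _ (vV (maxn N L))) // gerBl normsq_ge0.
Qed.

Lemma dot_tail v N k : square_summable v ->
  dot (b k) v = apply_mx b N v k + dot (b k) (tail N v).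
Proof.
move=> sv; apply: dot_eq.
have : (fun L => apply_mx b N v k + apply_mx b L (tail N v) k) ~>
    (apply_mx b N v k + dot (b k) (tail N v)).
  apply: climD; first exact: clim_cst.
  by apply: dot_apply_cvg; exact: square_summable_tail_seq.
by apply: (clim_eventually (N0 := N)) => L NL; rewrite -apply_tail.
Qed.

(** Both sides depend continuously on v and agree, by finite linearity, when v
    is finitely supported: the difference between the left-hand side and a
    partial sum of the right-hand side is the pairing of u with the image under
    b of a tail of v. *)
Lemma dot_assoc u v : square_summable u -> square_summable v ->
  dot u (fun k => dot (b k) v) = dot (fun l => dot u (fun k => b k l)) v.
Proof.
move=> su sv; apply/esym/dot_eq/clim_le => e e0.
have [U uU] := su.
have U0 : 0 <= U by apply: le_trans (uU 0); exact: normsq_ge0.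
have U1 : 0 < U + 1 by rewrite ltr_wpDl.
(* The weight t makes the u-part of the bound at most e; the tail of v is then
   chosen so small that its part, t^-1 M^2 |tail|^2, is at most e. *)
pose t := e / (U + 1).
have t0 : 0 < t by rewrite divr_gt0.
have d0 : 0 < t * e / M ^+ 2.
  apply: divr_gt0; [exact: mulr_gt0 | exact: exprn_gt0].
have [N0 H] := square_summable_tail sv d0.
exists N0 => N N0N.
have scol l : square_summable (fun k => b k l).
  exact: form_bounded_col bM.
have PE : partial_dot (fun l => dot u (fun k => b k l)) v N =
    dot u (apply_mx b N v).
  apply/esym/dot_eq.
  have := @clim_dot_sum N (fun l k => b k l) u v scol su.
  rewrite /partial_dot; under [X in _ ~> X -> _]eq_bigr do rewrite mulrC.
  apply: (clim_eventually (N0 := 0)) => K _; apply: eq_bigr => k _.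
  by congr (_ * _); apply: eq_bigr => l _; rewrite mulrC.
have st := square_summable_tail_seq N sv.
have sbt := square_summable_dot st.
have sbN : square_summable (apply_mx b N v).
  have [V vV] := sv.
  exists (M ^+ 2 * V) => K; apply: le_trans (form_bounded_apply K N v M0 bM) _.
  by rewrite ler_wpM2l // exprn_ge0 // ltW.
rewrite PE.
have -> : dot u (fun k => dot (b k) v) - dot u (apply_mx b N v) =
    dot u (fun k => dot (b k) (tail N v)).
  rewrite (_ : (fun k => dot (b k) v) =
      fun k => apply_mx b N v k + dot (b k) (tail N v)); last first.
    by apply/funext => k; exact: dot_tail.
  by rewrite dotC dotDl // dotC addrC addKr dotC.
have := dot_le t0 su sbt uU (V := M ^+ 2 * (t * e / M ^+ 2)) _.
have -> : M ^+ 2 * (t * e / M ^+ 2) = t * e by field; rewrite gt_eqF.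
rewrite mulrA mulVf ?gt_eqF // mul1r => h.
have {}h : 2 * `|dot u (fun k => dot (b k) (tail N v))| <= t * U + e.
  apply: h => K; rewrite -[t * e](_ : M ^+ 2 * (t * e / M ^+ 2) = _); last first.
    by field; rewrite gt_eqF.
  apply: normsq_dot_le => L; rewrite normsq_tail lerBlDr addrC.
  by rewrite (le_trans (H _)) // lerD2r normsq_mono.
have : t * U + e <= 2 * e.
  rewrite [2 * e]mulr_natl mulr2n lerD2r /t mulrAC ler_pdivrMr //.
  by rewrite ler_wpM2l ?(ltW e0) // lerDl.
by move=> /(le_trans h); rewrite ler_pM2l.
Qed.

End Assoc.

End Dot.

Section Products.
Variable R : realType.
Local Notation C := R[i].
Local Notation "s ~> l" := ((s : nat -> C^o) @ \oo --> (l : C^o)) (at level 70).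
Variables (M M' : C) (a b : nat -> nat -> C).
Hypotheses (M0 : 0 < M) (M'0 : 0 < M').
Hypotheses (aM : form_bounded M a) (bM : form_bounded M' b).

Definition mul_mx i j : C := dot (a i) (fun k => b k j).

(** The form of a product is the limit of the pairings of the truncations of
    y a and b x. *)
Lemma mul_form_cvg K N x y :
  partial_dot (apply_mx (fun i j => a j i) K y) (apply_mx b N x) ~>
  form mul_mx K N x y.
Proof.
have := @clim_sum R _ \oo _ K
  (fun i L => \sum_(j < N) y i * partial_dot (a i) (fun k => b k j) L * x j)
  (fun i => \sum_(j < N) y i * mul_mx i j * x j) _.
have h : (fun L => \sum_(i < K) \sum_(j < N)
      y i * partial_dot (a i) (fun k => b k j) L * x j) =
    partial_dot (apply_mx (fun i j => a j i) K y) (apply_mx b N x).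
  apply/funext => L; rewrite /partial_dot /apply_mx.
  under eq_bigr do under eq_bigr do rewrite mulr_sumr mulr_suml.
  under eq_bigr do rewrite exchange_big.
  rewrite exchange_big; apply: eq_bigr => k _ /=.
  rewrite mulr_suml; apply: eq_bigr => i _; rewrite mulr_sumr.
  by apply: eq_bigr => j _; ring.
rewrite h; apply => i.
apply: (@clim_sum R _ \oo _ N
  (fun j L => y i * partial_dot (a i) (fun k => b k j) L * x j)
  (fun j => y i * mul_mx i j * x j)) => j.
rewrite mulrAC; under eq_fun do rewrite mulrAC.
apply: climZ; apply: dot_cvg.
  exact: form_bounded_row aM.
exact: form_bounded_col bM.
Qed.

(** The weight M'/M balances the two factors. *)
Lemma form_bounded_mul : form_bounded (M * M') mul_mx.
Proof.
move=> K N x y; rewrite mulrC -ler_pdivlMr //.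
apply: norm_lim_le (mul_form_cvg (K := K) (N := N) (x := x) (y := y)) _; exists 0%N => // L _.
have t0 : 0 < M' / M by rewrite divr_gt0.
rewrite /= ler_pdivlMr // mulrC (le_trans (sum_amgm _ _ _ t0)) //.
have -> : M * M' * (normsq N x + normsq K y) = M' / M * (M ^+ 2 * normsq K y) +
    (M' / M)^-1 * (M' ^+ 2 * normsq N x).
  by field; rewrite !gt_eqF.
rewrite lerD // ler_wpM2l ?invr_ge0 ?(ltW t0) //.
  exact: form_bounded_apply (form_bounded_tr aM).
exact: form_bounded_apply bM.
Qed.

End Products.

Section BoundedMatrix.
Variable R : realType.
Local Notation C := R[i].
Implicit Types (a b : nat -> nat -> C).

Definition bounded_mx : {pred nat -> nat -> C} :=
  fun a => `[< exists2 M : R, 0 < M & form_bounded M%:C a >].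

Lemma bounded_mxP a :
  reflect (exists2 M : R, 0 < M & form_bounded M%:C a) (a \in bounded_mx).
Proof. exact: asboolP. Qed.

Lemma form0 K N (x y : nat -> C) : form (fun _ _ => 0) K N x y = 0.
Proof.
by rewrite /form big1 // => i _; rewrite big1 // => j _; rewrite mulr0 mul0r.
Qed.

Lemma bounded_mx_submod : submod_closed bounded_mx.
Proof.
split.
  apply/bounded_mxP; exists 1 => // K N x y.
  rewrite (_ : form _ _ _ _ _ = 0) ?form0 // normr0 mulr0 mulr_ge0 //.
  by rewrite addr_ge0 // normsq_ge0.
move=> c a b /bounded_mxP[M M0 aM] /bounded_mxP[M' M'0 bM].
have [m m0 mE] := gec0P (normr_ge0 c).
apply/bounded_mxP; exists (m * M + M'); first by rewrite ltr_wpDl // mulr_ge0 // ltW.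
rewrite rmorphD rmorphM /= -mE.
exact: form_boundedD (form_boundedZ c aM) bM.
Qed.

HB.instance Definition _ :=
  GRing.isSubmodClosed.Build C (nat -> nat -> C) bounded_mx bounded_mx_submod.

Record bounded_matrix := BoundedMatrix {
  entry :> nat -> nat -> C;
  _ : entry \in bounded_mx }.

HB.instance Definition _ := [isSub for entry].
HB.instance Definition _ := [Choice of bounded_matrix by <:].
HB.instance Definition _ := [SubChoice_isSubLmodule of bounded_matrix by <:].

Implicit Types A B D : bounded_matrix.

Lemma entry_bounded A : exists2 M : R, 0 < M & form_bounded M%:C A.
Proof. by case: A => a /= /bounded_mxP. Qed.

Lemma entry_row A i : square_summable (A i).
Proof.
have [M M0 AM] := entry_bounded A.
by apply: form_bounded_row AM; rewrite ltcR.
Qed.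

Lemma entry_col A j : square_summable (fun i => A i j).
Proof.
have [M M0 AM] := entry_bounded A.
by apply: form_bounded_col AM; rewrite ltcR.
Qed.
Hint Resolve entry_row entry_col : core.

Lemma matrixP A B : (forall i j, A i j = B i j) -> A = B.
Proof. by move=> AB; apply/val_inj/funext => i; apply/funext => j; exact: AB. Qed.

Lemma bmul_subproof A B : mul_mx A B \in bounded_mx.
Proof.
have [M M0 AM] := entry_bounded A; have [M' M'0 BM] := entry_bounded B.
apply/bounded_mxP; exists (M * M'); first by rewrite mulr_gt0.
by rewrite rmorphM; apply: form_bounded_mul => //; rewrite ltcR.
Qed.

Definition bmul A B := BoundedMatrix (bmul_subproof A B).

Lemma bstar_subproof A : (fun i j => (A j i)^*%C) \in bounded_mx.
Proof.
have [M M0 AM] := entry_bounded A; apply/bounded_mxP; exists M => //.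
exact: form_bounded_conj (form_bounded_tr AM).
Qed.

Definition bstar A := BoundedMatrix (bstar_subproof A).

Lemma bmulA : associative bmul.
Proof.
move=> A B D; apply: matrixP => i j; have [M M0 BM] := entry_bounded B.
have M0' : 0 < M%:C :> C by rewrite ltcR.
exact: (dot_assoc M0' BM (entry_row A i) (entry_col D j)).
Qed.

Lemma bmulDl : left_distributive bmul +%R.
Proof.
move=> A B D; apply: matrixP => i j.
exact: (dotDl (entry_row A i) (entry_row B i) (entry_col D j)).
Qed.

Lemma bmulDr : right_distributive bmul +%R.
Proof.
move=> A B D; apply: matrixP => i j.
change (dot (A i) (fun k => B k j + D k j) =
  dot (A i) (fun k => B k j) + dot (A i) (fun k => D k j)).
by rewrite dotC dotDl // dotC (dotC (D ^~ j)).
Qed.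

Lemma bmulZl (c : C) A B : bmul (c *: A) B = c *: bmul A B.
Proof.
by apply: matrixP => i j; exact: (dotZl c (entry_row A i) (entry_col B j)).
Qed.

Lemma bmulZr (c : C) A B : bmul A (c *: B) = c *: bmul A B.
Proof.
apply: matrixP => i j.
change (dot (A i) (fun k => c * B k j) = c * dot (A i) (fun k => B k j)).
by rewrite dotC dotZl // dotC.
Qed.

Lemma bstarK : involutive bstar.
Proof. by move=> A; apply: matrixP => i j; exact: conjcK. Qed.

Lemma bstarD : {morph bstar : A B / A + B}.
Proof.
move=> A B; apply: matrixP => i j.
change ((A j i + B j i)^*%C = (A j i)^*%C + (B j i)^*%C).
by rewrite rmorphD.
Qed.

Lemma conjcE (c : C) : Num.conj c = c^*%C.
Proof. by []. Qed.

Lemma bstarZ (c : C) A : bstar (c *: A) = Num.conj c *: bstar A.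
Proof.
rewrite conjcE; apply: matrixP => i j.
change ((c * A j i)^*%C = c^*%C * (A j i)^*%C).
by rewrite rmorphM.
Qed.

Lemma bstarM A B : bstar (bmul A B) = bmul (bstar B) (bstar A).
Proof.
apply: matrixP => i j.
change ((dot (A j) (fun k => B k i))^*%C =
  dot (fun k => (B k i)^*%C) (fun k => (A j k)^*%C)).
by rewrite dotC -dot_conj.
Qed.

Definition opnorm A : R := inf [set M : R | 0 <= M /\ form_bounded M%:C A].

Lemma opnorm_le A (M : R) : 0 <= M -> form_bounded M%:C A -> opnorm A <= M.
Proof. by move=> M0 AM; apply: ge_inf => //; exists 0 => ? []. Qed.

Lemma opnorm_has_inf A : has_inf [set M : R | 0 <= M /\ form_bounded M%:C A].
Proof.
split; last by exists 0 => ? [].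
by have [M M0 AM] := entry_bounded A; exists M; split => //; exact: ltW.
Qed.

Lemma opnorm_ge0 A : 0 <= opnorm A.
Proof. by apply: lb_le_inf; [case: (opnorm_has_inf A) | move=> ? []]. Qed.

(** The infimum is attained since the condition on M is closed. *)
Lemma opnorm_bounded A : form_bounded (opnorm A)%:C A.
Proof.
apply: form_bounded_epsilon => _ /gtc0P[e e0 ->].
have [M [M0 AM] Me] := inf_adherent e0 (opnorm_has_inf A).
by apply: form_boundedW AM; rewrite -rmorphD lecR ltW.
Qed.

Lemma opnormD A B : opnorm (A + B) <= opnorm A + opnorm B.
Proof.
apply: opnorm_le; first by rewrite addr_ge0 // opnorm_ge0.
rewrite rmorphD; exact: (form_boundedD (opnorm_bounded A) (opnorm_bounded B)).
Qed.

Lemma opnormZ_le (c : C) A : (opnorm (c *: A))%:C <= `|c| * (opnorm A)%:C.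
Proof.
have [m m0 mE] := gec0P (normr_ge0 c).
rewrite mE -rmorphM lecR; apply: opnorm_le.
  by rewrite mulr_ge0 // opnorm_ge0.
have -> : (m * opnorm A)%:C = `|c| * (opnorm A)%:C by rewrite mE rmorphM.
exact: (form_boundedZ c (opnorm_bounded A)).
Qed.

Lemma opnorm_eq0 A : opnorm A = 0 -> A = 0.
Proof.
move=> A0; apply: matrixP => i j; apply/eqP; rewrite -normr_le0.
have := opnorm_bounded A; rewrite A0; exact: form_bounded_entry.
Qed.

Definition norm_mx A : C := (opnorm A)%:C.

Lemma norm_mxD A B : norm_mx (A + B) <= norm_mx A + norm_mx B.
Proof. by rewrite -rmorphD lecR opnormD. Qed.

Lemma norm_mxZ (c : C) A : norm_mx (c *: A) = `|c| * norm_mx A.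
Proof.
apply/eqP; rewrite eq_le opnormZ_le /=.
have [->|c0] := eqVneq c 0; first by rewrite normr0 mul0r ler0c opnorm_ge0.
rewrite -ler_pdivlMl ?normr_gt0 // -normfV.
by apply: le_trans (opnormZ_le _ _); rewrite scalerA mulVf // scale1r.
Qed.

Lemma norm_mx_eq0 A : norm_mx A = 0 -> A = 0.
Proof. by case=> /opnorm_eq0. Qed.

HB.instance Definition _ := @Lmodule_isNormed.Build C bounded_matrix
  norm_mx norm_mxD norm_mxZ norm_mx_eq0.

Lemma norm_matrixE A : `|A| = (opnorm A)%:C.
Proof. by []. Qed.

Lemma entry_le_norm A i j : `|A i j| <= `|A|.
Proof. exact: form_bounded_entry (opnorm_bounded A). Qed.

End BoundedMatrix.

Section BoundedMatrixCStar.
Variable R : realType.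
Local Notation C := R[i].
Local Notation "s ~> l" := ((s : nat -> C^o) @ \oo --> (l : C^o)) (at level 70).
Local Notation matrix := (bounded_matrix R).
Implicit Types A B D : matrix.

Lemma norm_mulmx A B : `|bmul A B| <= `|A| * `|B|.
Proof.
have [->|A0] := eqVneq A 0.
  rewrite -(scale0r (0 : matrix)) bmulZl !scale0r.
  by rewrite normr0 mul0r.
have [->|B0] := eqVneq B 0.
  rewrite -(scale0r (0 : matrix)) bmulZr !scale0r.
  by rewrite normr0 mulr0.
have pos D : D != 0 -> 0 < (opnorm D)%:C :> C by rewrite -normr_gt0.
rewrite !norm_matrixE -rmorphM lecR; apply: opnorm_le.
  by rewrite mulr_ge0 // opnorm_ge0.
rewrite rmorphM; exact: (form_bounded_mul (pos _ A0) (pos _ B0)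
  (opnorm_bounded A) (opnorm_bounded B)).
Qed.

Lemma norm_bstar_le A : `|bstar A| <= `|A|.
Proof.
rewrite !norm_matrixE lecR; apply: opnorm_le; first exact: opnorm_ge0.
exact: (form_bounded_conj (form_bounded_tr (opnorm_bounded A))).
Qed.

(** The truncations of |A x|^2 increase to <A^* A x, x>. *)
Lemma gram_le A K N x :
  normsq K (apply_mx A N x) <= `|bmul (bstar A) A| * normsq N x.
Proof.
set z := apply_mx A N x; set G := bmul _ _.
have [M M0 AM] := entry_bounded A.
have M0' : 0 < M%:C :> C by rewrite ltcR.
have AM' := form_bounded_conj (form_bounded_tr AM).
have cv := @mul_form_cvg R _ _ _ _ M0' M0' AM' AM N N x (fun i => (x i)^*%C).
have zz : partial_dot (apply_mx (fun i j => (A i j)^*%C) N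
    (fun i => (x i)^*%C)) (apply_mx A N x) = (fun L => normsq L z).
  apply/funext => L; apply: eq_bigr => k _; rewrite sqr_normc mulrC.
  congr (_ * _); rewrite /z /apply_mx rmorph_sum; apply: eq_bigr => j _.
  by rewrite rmorphM.
rewrite zz in cv; set l := form _ _ _ _ _ in cv.
have lG : `|l| <= `|G| * normsq N x.
  rewrite -(ler_pM2l (ltr0n _ 2)).
  apply: le_trans (opnorm_bounded G N N x (fun i => (x i)^*%C)) _.
  rewrite normsqC -norm_matrixE.
  by rewrite le_eqVlt; apply/orP; left; apply/eqP; ring.
apply: lec_epsilon => e e0.
have [N0 H] := (clim_le _ _).1 cv e e0.
have := H (maxn N0 K) (leq_maxl _ _).
have := normsq_mono z (leq_maxr N0 K).
move: (maxn N0 K) => L zL lL.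
apply: le_trans zL _; rewrite -(ger0_norm (normsq_ge0 L z)).
apply: (le_trans _ (lerD lG lL)).
rewrite -{1}(subrK l (normsq L z)) addrC (le_trans (ler_normD _ _)) //.
by rewrite lerD2l distrC.
Qed.

(** The square root of k = |A^* A| bounds the form of A by [gram_le]; adding e
    covers the case k = 0, where the weight in [sum_amgm] would be 0. *)
Lemma norm_gram_ge A : `|A| ^+ 2 <= `|bmul (bstar A) A|.
Proof.
rewrite !norm_matrixE; set k := opnorm (bmul _ _).
have k0 : 0 <= k by apply: opnorm_ge0.
rewrite -rmorphXn lecR /= -(sqr_sqrtr k0) ler_sqr ?nnegrE ?sqrtr_ge0 ?opnorm_ge0 //.
apply/ler_addgt0Pr => e e0; set t := Num.sqrt k + e.
have t0 : 0 < t by rewrite ltr_wpDl // sqrtr_ge0.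
have kt : k <= t ^+ 2.
  by rewrite -{1}(sqr_sqrtr k0) ler_sqr ?nnegrE ?sqrtr_ge0 // ?lerDl ltW.
have t0' : 0 < t%:C :> C by rewrite ltcR.
apply: opnorm_le; first exact: ltW.
move=> K N x y; rewrite formE.
apply: le_trans (sum_amgm _ _ _ t0') _.
rewrite mulrDr addrC lerD2r -ler_pdivlMl ?invr_gt0 // invrK mulrA -expr2.
apply: le_trans (gram_le A K N x) _.
by rewrite norm_matrixE ler_wpM2r ?normsq_ge0 // -rmorphXn lecR.
Qed.

Lemma norm_gram A : `|bmul (bstar A) A| = `|A| ^+ 2.
Proof.
apply/eqP; rewrite eq_le norm_gram_ge andbT expr2.
by rewrite (le_trans (norm_mulmx _ _)) // ler_wpM2r // norm_bstar_le.
Qed.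

(** Entries are 1-Lipschitz, so they converge along F; the bounds on forms are
    closed conditions on finitely many entries, so they pass to the entrywise
    limit, which is therefore also the limit in norm. *)
Lemma matrix_complete (F : set_system matrix) :
  ProperFilter F -> cauchy F -> cvg F.
Proof.
move=> FF /cauchyP Fc.
have ecv i j : cvg ((fun A : matrix => A i j : C^o) @ F).
  apply: complex_complete; apply: cauchy_exP => e /Fc[A FA]; exists (A i j).
  change (F ((fun D : matrix => D i j : C^o) @^-1` ball (A i j : C^o) e)).
  apply: filterS FA => D AD.
  exact: le_lt_trans (entry_le_norm (A - D) i j) AD.
pose l i j : C := lim ((fun A : matrix => A i j : C^o) @ F).
have near_l (e : C) : 0 < e -> exists2 A : matrix, F (ball A e) &
    form_bounded e (fun i j => A i j + -1 * l i j).
  move=> e0; have [A FA] := Fc e e0; exists A => // K N x y.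
  have cv : (fun D : matrix =>
        form (fun i j => A i j + -1 * D i j) K N x y : C^o) @ F -->
      (form (fun i j => A i j + -1 * l i j) K N x y : C^o).
    apply: (@clim_sum R _ F _ K
      (fun i (D : matrix) => \sum_(j < N) y i * (A i j + -1 * D i j) * x j)
      (fun i => \sum_(j < N) y i * (A i j + -1 * l i j) * x j)) => i.
    apply: (@clim_sum R _ F _ N
      (fun j (D : matrix) => y i * (A i j + -1 * D i j) * x j)
      (fun j => y i * (A i j + -1 * l i j) * x j)) => j.
    under eq_fun do rewrite mulrAC; rewrite mulrAC.
    apply: climZ; apply: climD; first exact: clim_cst.
    by apply: climZ; exact: ecv.
  rewrite mulrC -ler_pdivlMr //.
  apply: norm_lim_le cv _; apply: filterS FA => D AD /=.
  rewrite /= ler_pdivlMr // mulrC.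
  have AD' : `|A - D| <= e := ltW AD.
  have := form_boundedW AD' (opnorm_bounded (A - D)) K N x y.
  rewrite (_ : entry (A - D) = fun i j => A i j + -1 * D i j) //.
  by apply/funext => i; apply/funext => j; rewrite mulN1r.
have [A0 _ A0l] := near_l 1 ltr01.
have lb : l \in @bounded_mx R.
  have [M M0 AM] := entry_bounded A0.
  apply/bounded_mxP; exists (M + 1); first by rewrite addr_gt0.
  have := form_boundedD AM (form_boundedZ (-1) A0l).
  rewrite normrN normr1 mulr1 rmorphD rmorph1.
  rewrite (_ : (fun i j => _) = l) //.
  by apply/funext => i; apply/funext => j; ring.
apply/cvg_ex; exists (BoundedMatrix lb).
apply/cvgrPdist_le => e e0.
have e2 : 0 < e / 2 by rewrite divr_gt0.
have [A FA Al] := near_l _ e2.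
have [r r0 rE] := gtc0P e2.
have AL : `|A - BoundedMatrix lb| <= e / 2.
  rewrite norm_matrixE rE lecR; apply: opnorm_le; first exact: ltW.
  rewrite -rE (_ : entry _ = fun i j => A i j + -1 * l i j) //.
  by apply/funext => i; apply/funext => j; rewrite mulN1r.
apply: filterS FA => D AD.
rewrite -(subrK A (BoundedMatrix lb)) -addrA (splitr e).
apply: le_trans (ler_normD _ _) _; apply: lerD; first by rewrite distrC.
exact: (ltW AD).
Qed.

HB.instance Definition _ := Uniform_isComplete.Build matrix matrix_complete.

HB.instance Definition _ := CompleteNormedModule_isCStarAlgebra.Build R matrix
  (@bmulA R) (@bmulDl R) (@bmulDr R) (@bmulZl R) (@bmulZr R) (@bstarK R)
  (@bstarD R) (@bstarZ R) (@bstarM R) norm_mulmx norm_gram.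

End BoundedMatrixCStar.

(** * Non-vanishing of the target of f_0 *)

Section ProperIsometry.
Variables (R : realType) (n : nat) (A : cstarAlgType R) (s : A).
Local Notation e := (s^*c *c s).
Local Notation r := (s *c s^*c).
Local Notation p := (s^*c *c s - s *c s^*c).
Hypotheses (es : e *c s = s) (se : s *c e = s).

Lemma isometry_unit_projection : is_projection e.
Proof. by split; [rewrite -cmulA se | rewrite cstarM cstarK]. Qed.

Let pe := isometry_unit_projection.

Let se' : s^*c *c e = s^*c.
Proof. by have := congr1 (@cstar R A) es; rewrite cstarM (proj2 pe). Qed.

Lemma range_projection : is_projection r.
Proof. by split; [rewrite cmulA -(cmulA s) se | rewrite cstarM cstarK]. Qed.

Let er : e *c r = r. Proof. by rewrite cmulA es. Qed.
Let re : r *c e = r. Proof. by rewrite -cmulA se'. Qed.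

Lemma defect_projection : is_projection p.
Proof.
have [[ee e1] [rr r1]] := (pe, range_projection); split; last first.
  by rewrite cstarB e1 r1.
by rewrite cmulBl !cmulBr ee er re rr subrr subr0.
Qed.

Lemma range_defect : r *c p = 0.
Proof. by rewrite cmulBr re (proj1 range_projection) subrr. Qed.

Lemma defect_range : p *c r = 0.
Proof. by rewrite cmulBl er (proj1 range_projection) subrr. Qed.

Let ep : e *c p = p.
Proof. by rewrite cmulBr er (proj1 pe). Qed.

(** When s is an isometry that is not unitary, with unit e = s^* s, the vertex
    w_0 carries its range projection r = s s^* and w_1 the defect p = e - r.
    The loop at w_0 is s r and the edge f_0 is s p; all vertices and edges
    beyond w_1 are sent to 0. *)
Definition toeplitz_vertex (v : vertex (Sigmat n.+1)) : A :=
  if v == 0%N :> nat then r else if v == 1%N :> nat then p else 0.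

Definition toeplitz_edge (x : edge (Sigmat n.+1)) : A :=
  match x with
  | inl v => if v == 0%N :> nat then s *c r else if v == 1%N :> nat then p else 0
  | inr j => if j == 0%N :> nat then s *c p else 0
  end.

(** At w_0 the relation reads s r s^* + s p s^* = s e s^* = r. *)
Lemma toeplitz_family : ck_family toeplitz_vertex toeplitz_edge.
Proof.
have [rr rs] := range_projection; have [pp ps] := defect_projection.
have sxx x : x^*c = x -> x *c x = x -> (s *c x)^*c *c (s *c x) = x *c e *c x.
  by move=> xs xx; rewrite cstarM xs !cmulA.
apply: ck_familyI.
- move=> v; rewrite /toeplitz_vertex; case: ifP => _.
    exact: range_projection.
  by case: ifP => _; [exact: defect_projection | exact: projection0].
- move=> v w vw; rewrite /toeplitz_vertex.
  case: (altP (v =P 0%N :> nat)) => v0; case: (altP (w =P 0%N :> nat)) => w0.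
  + by case: vw; apply: val_inj; rewrite /= v0 w0.
  + by case: ifP => _; [exact: range_defect | exact: cmul0].
  + by case: ifP => _; [exact: defect_range | exact: cmul0l].
  + case: (altP (v =P 1%N :> nat)) => v1; case: (altP (w =P 1%N :> nat)) => w1;
      rewrite ?cmul0 ?cmul0l //.
    by case: vw; apply: val_inj; rewrite /= v1 w1.
- case=> [v|j]; rewrite /toeplitz_edge /toeplitz_vertex /=.
    case: ifP => _; first by rewrite sxx // re.
    by case: ifP => _; [rewrite ps pp | rewrite cmul0].
  rewrite /bump /= add1n eqSS; case: ifP => _; last by rewrite cmul0.
  by rewrite sxx // -cmulA ep.
- move=> v _; rewrite sigmat_source_sum /= /toeplitz_vertex.
  have rngE x : x^*c = x -> x *c x = x -> s *c x *c (s *c x)^*c = s *c x *c s^*c.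
    by move=> xs xx; rewrite cstarM xs -!cmulA (cmulA x x) xx.
  case: (altP (v =P 0%N :> nat)) => v0.
    rewrite (big_pred1 ord0); last first.
      by move=> j /=; rewrite -!val_eqE /= v0.
    rewrite /= !rngE // -cmulDl -cmulDr addrC subrK.
    by rewrite se.
  rewrite big1 ?addr0; last first.
    move=> j /eqP jv; rewrite (_ : (j : nat) == 0%N = false) ?cmul0l //.
    by apply/negP => /eqP j0; move: v0; rewrite -jv /= j0.
  by case: ifP => _; rewrite ?ps ?pp ?cmul0l.
Qed.

End ProperIsometry.

Section Shift.
Variable R : realType.
Local Notation C := R[i].

Definition shift_mx (i j : nat) : C := (i == j.+1)%:R.

Lemma apply_shift N x i :
  apply_mx shift_mx N x i = if i is k.+1 then (if (k < N)%N then x k else 0) else 0.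
Proof.
rewrite /apply_mx /shift_mx; case: i => [|k].
  by rewrite big1 // => j _; rewrite mul0r.
case: ltnP => kN.
  rewrite (bigD1 (Ordinal kN)) //= eqxx mul1r big1 ?addr0 // => j jk.
  by rewrite eqSS eq_sym (_ : (_ == _) = false) ?mul0r //; exact: negbTE.
rewrite big1 // => j _; rewrite eqSS (gtn_eqF (leq_trans (ltn_ord j) kN)).
by rewrite mul0r.
Qed.

Lemma normsq_shift K N x : normsq K (apply_mx shift_mx N x) <= normsq N x.
Proof.
case: K => [|K]; first by rewrite /normsq big_ord0; exact: normsq_ge0.
rewrite /normsq big_ord_recl apply_shift normr0 expr0n add0r.
apply: le_trans (normsq_mono x (geq_minr K N)).
rewrite (eq_bigr (fun k : 'I_K => `|if (k < N)%N then x k else 0| ^+ 2)); last first.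
  by move=> k _; rewrite apply_shift.
rewrite le_eqVlt; apply/orP; left; apply/eqP.
elim: K => [|K IH]; first by rewrite min0n /normsq !big_ord0.
rewrite big_ord_recr /= IH; case: ltnP => KN.
  by rewrite (minn_idPl KN) normsqS.
by rewrite normr0 expr0n addr0 (minn_idPr (leqW KN)).
Qed.

Lemma shift_bounded : shift_mx \in @bounded_mx R.
Proof.
apply/bounded_mxP; exists 1 => // K N x y; rewrite formE.
apply: le_trans (sum_amgm _ _ _ ltr01) _.
by rewrite invr1 !mul1r addrC lerD2r normsq_shift.
Qed.

Definition shift : bounded_matrix R := BoundedMatrix shift_bounded.

(** The partial sums are eventually constant. *)
Lemma dot_delta i v : dot (fun k => (k == i)%:R : C) v = v i.
Proof.
apply: dot_eq; apply/clim_le => e e0; exists i.+1 => N iN.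
rewrite /partial_dot (bigD1 (Ordinal iN)) //= eqxx mul1r big1 ?addr0.
  by rewrite subrr normr0 ltW.
by move=> k ki; rewrite (_ : (_ == _) = false) ?mul0r //; exact: negbTE.
Qed.

Lemma shift_gram i j : (shift^*c *c shift) i j = (i == j)%:R.
Proof.
rewrite [LHS](_ : _ = dot (fun k => (k == i.+1)%:R : C) (fun k => (k == j.+1)%:R)).
  by rewrite dot_delta eqSS.
rewrite [LHS](_ : _ = dot (fun k => ((k == i.+1)%:R)^*%C : C) (fun k => (k == j.+1)%:R)) //.
by under eq_fun do rewrite conjc_nat.
Qed.

Lemma gram_shift : shift^*c *c shift *c shift = shift.
Proof.
apply: matrixP => i j.
rewrite [LHS](_ : _ = dot (fun k => (shift^*c *c shift) i k) (fun k => shift k j)) //.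
under eq_fun do rewrite shift_gram eq_sym.
exact: dot_delta.
Qed.

Lemma shift_mul_gram : shift *c (shift^*c *c shift) = shift.
Proof.
apply: matrixP => i j.
rewrite [LHS](_ : _ = dot (fun k => shift i k) (fun k => (shift^*c *c shift) k j)) //.
rewrite dotC; under eq_fun do rewrite shift_gram.
exact: dot_delta.
Qed.

(** The defect is the projection on the first basis vector, whose entry at
    (0, 0) is 1. *)
Lemma shift_defect_neq0 : shift^*c *c shift - shift *c shift^*c != 0.
Proof.
apply/eqP => /(congr1 (fun D : bounded_matrix R => D 0%N 0%N)).
rewrite [LHS](_ : _ = (shift^*c *c shift) 0%N 0%N - (shift *c shift^*c) 0%N 0%N) //.
rewrite shift_gram.
rewrite (_ : (shift *c shift^*c) 0%N 0%N = dot (fun k => (0%N == k.+1)%:R : C)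
  (fun k => ((0%N == k.+1)%:R)^*%C)) //.
rewrite (@dot_eq _ _ _ 0) ?subr0; first by move/eqP; rewrite oner_eq0.
rewrite (_ : partial_dot _ _ = fun=> 0); first exact: clim_cst.
by apply/funext => N; rewrite /partial_dot big1 // => k _; rewrite mul0r.
Qed.

End Shift.

Lemma vertex1_neq0 (R : realType) (n : nat) (A : graph_cstar R (Sigmat n))
  (v : 'I_n.+1) : v = 1%N :> nat -> gP A v != 0.
Proof.
case: n A v => [|n] A v v1; first by case: v v1 => m /=; lia.
have ck := toeplitz_family n (gram_shift R) (shift_mul_gram R).
have [f [[fh fP _] _]] := g_universal A ck.
apply/eqP => P0; have := fP v.
rewrite P0 (star_hom0 fh) /toeplitz_vertex v1 /= => /esym/eqP.
by apply/negP; exact: shift_defect_neq0.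
Qed.

(** * The isomorphism *)

Theorem theorem3p11 (R : realType) (n : nat)
    (A : graph_cstar R (Sigmat n)) (B : graph_cstar R (Sigma n)) :
  exists (psi : A -> B) (psi_inv : B -> A),
    (star_hom psi /\ star_hom psi_inv) /\
    (cancel psi psi_inv /\ cancel psi_inv psi) /\
    ((forall i : 'I_n.+1, psi (gP A i) = gP B i) /\
     (forall i : 'I_n.+1, psi (Sloop A i) = Se B i i) /\
     (forall j : 'I_n, psi (Sf A j) =
        \sum_(k < n.+1 | (j < k)%N)
          Se B (widen_ord (leqnSn n) j) k *c (Se B (lift ord0 j) k)^*c)) /\
    ((forall i : 'I_n.+1, psi_inv (gP B i) = gP A i) /\
     (forall i : 'I_n.+1, psi_inv (Se B i i) = Sloop A i) /\
     (forall j k : 'I_n.+1, (j < k)%N -> psi_inv (Se B j k) = Spath A j k)) /\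
    ((0 < n)%N -> ~ u1_equivariant psi).
Proof.
have [psi [[psiH psiP psiS] _]] := g_universal A (Sigmat_image_family B).
have [psi' [[psi'H psi'P psi'S] _]] := g_universal B (Sigma_image_family A).
have psi'Se (j k : 'I_n.+1) : (j <= k)%N -> psi' (Se B j k) = Spath A j k.
  by move=> jk; rewrite Se_edge psi'S.
(* Splitting off S_{f_j} from the path turns into multiplication by F_j. *)
have psiSpath (j k : 'I_n.+1) : (j <= k)%N -> psi (Spath A j k) = Se B j k.
  elim/ord_descending_ind: j k => [|i IH] k.
    move=> nk; have -> : k = ord_max.
      by apply: val_inj => /=; move: nk (ltn_ord k) => /=; lia.
    by rewrite Spath_diag psiS.
  rewrite leq_eqVlt => /orP[/eqP/val_inj <-|ik]; first by rewrite Spath_diag psiS.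
  rewrite Spath_cons // (star_homM psiH) IH ?lift0 //.
  by rewrite psiS /= Sf_image_mul.
have psi'Sf (j : 'I_n) : psi' (Sf_image B j) = Sf A j.
  rewrite /Sf_image star_hom_sum // -[RHS]Sf_mul_Spath_sum; apply: eq_bigr => k jk.
  by rewrite (star_homM psi'H) (star_homS psi'H) !psi'Se ?lift0 // ltnW.
have psiK : cancel psi psi'.
  apply: (graph_hom_unique (g_family A) (star_hom_comp psiH psi'H)
    (star_hom_id A)) => //= [v|e]; first by rewrite psiP psi'P.
  rewrite psiS; case: e => [i|j] /=; last exact: psi'Sf.
  by rewrite psi'Se // Spath_diag.
have psi'K : cancel psi' psi.
  apply: (graph_hom_unique (g_family B) (star_hom_comp psi'H psiH)
    (star_hom_id B)) => //= [v|e]; first by rewrite psi'P psiP.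
  by rewrite psi'S /Sigma_image psiSpath ?gS_Se //; case: e.
exists psi, psi'; split; first by [].
split; first by [].
split; first by split=> //; split; [move=> i; exact: (psiS (inl i))
                                  | move=> j; exact: (psiS (inr j))].
split.
  split=> //; split=> [i|j k jk]; first by rewrite psi'Se // Spath_diag.
  by rewrite psi'Se // ltnW.
move=> n0 equiv.
have [gA gAH] := gauge_action_exists A; have [gB gBH] := gauge_action_exists B.
pose j : 'I_n := Ordinal n0.
have m1 : `|-1 : R[i]| = 1 by rewrite normrN normr1.
have gBSe i k : gB (-1) (Se B i k) = - Se B i k.
  have hB := gauge_hom gBH m1.
  rewrite /Se; case: insub => [e|]; last by rewrite (star_hom0 hB) oppr0.
  by rewrite (gaugeS gBH) // scaleN1r.
(* For u = -1 both factors of every summand of F_j change sign, so F_j is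
   fixed, while S_{f_j} is negated. *)
have F0 : Sf_image B j = - Sf_image B j.
  have := equiv _ _ gAH gBH _ m1 (Sf A j).
  rewrite (gaugeS gAH) // scaleN1r -scaleN1r (star_homZ psiH) psiS scaleN1r => ->.
  have hB := gauge_hom gBH m1.
  rewrite [in RHS]/= /Sf_image star_hom_sum //; apply: eq_bigr => k jk.
  by rewrite (star_homM hB) (star_homS hB) !gBSe cstarN cmulNl cmulNr opprK.
have Fz : Sf_image B j = 0.
  have : `|Sf_image B j| *+ 2 == 0.
    by rewrite -normrMn mulr2n {1}F0 addNr normr0.
  by rewrite mulrn_eq0 normr_eq0 => /eqP.
have Sf0 : Sf A j = 0 by rewrite -psi'Sf Fz (star_hom0 psi'H).
have /eqP[] : gP A (lift ord0 j) != 0 by apply: vertex1_neq0; rewrite lift0.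
by rewrite -Sf_target Sf0 cmul0.
Qed.
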